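(* Let $\mathcal C$ be a GV-category. The following three groupoids are equivalent: 1. the category of GV-Frobenius algebras in $\mathcal C$ and their morphisms; 2. the category $\mathcal Alg^{\kappa}_{\mathcal C}$ whose objects are pairs $(A,\kappa)$ consisting of an algebra $A$ in $\mathcal C$ and an invariant non-degenerate GV-pairing $\kappa$ on $A$, and whose morphisms $(A,\kappa_A)\to(B,\kappa_B)$ are the algebra morphisms $f\colon A\to B$ such that $\kappa_B\circ(f\otimes f)=\kappa_A$; 3. the category of pairs $(A,\lambda)$ consisting of an algebra $A$ in $\mathcal C$ and a Frobenius form $\lambda$ on $A$, with morphisms $(A,\lambda_A)\to(B,\lambda_B)$ the algebra morphisms $f\colon A\to B$ such that $\lambda_B\circ f=\lambda_A$.
   Context: A GV-category is a monoidal category $(\mathcal C,\otimes,1)$ with a chosen dualizing object $K$: for every $y$ the functor $x\mapsto\mathrm{Hom}(x\otimes y,K)$ is represented by an object $Gy$, and the resulting contravariant functor $G$ is an anti-equivalence. The second tensor product is $x\odot y:=G^{-1}(Gy\otimes Gx)$, with unit $K$ and associator and unitors obtained by applying $G^{-1}$ to those of $\otimes$. There are natural adjunctions $\mathrm{Hom}(a\otimes b,c)\cong\mathrm{Hom}(b,G^{-1}a\odot c)$. In particular $c\odot{-}$ is right adjoint to $Gc\otimes{-}$, with counit $\mathrm{ev}_{c,y}\colon Gc\otimes(c\odot y)\to y$ and unit $\mathrm{coev}_{c,y}\colon y\to c\odot(Gc\otimes y)$; put $\mathrm{coev}^{\mathrm r}_c:=\mathrm{coev}_{c,1}\colon1\to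 c\odot Gc$. Distributors (natural, not necessarily invertible): $\delta^{\mathrm r}_{x,y,z}\colon(x\odot y)\otimes z\to x\odot(y\otimes z)$ corresponds under $\mathrm{Hom}(Gx\otimes((x\odot y)\otimes z),y\otimes z)\cong\mathrm{Hom}((x\odot y)\otimes z,x\odot(y\otimes z))$ to $\mathrm{ev}_{x,y}\otimes\mathrm{id}_z$ (precomposed with an associator); $\delta^{\mathrm l}_{x,y,z}\colon x\otimes(y\odot z)\to(x\otimes y)\odot z$ corresponds under $\mathrm{Hom}(x\otimes(y\odot z),(x\otimes y)\odot z)\cong\mathrm{Hom}(y\odot z,G^{-1}x\odot((x\otimes y)\odot z))$ to $\mathrm{coev}_{G^{-1}x,y}\odot\mathrm{id}_z$ (followed by an associator). An algebra in $\mathcal C$ is a unital associative algebra $(A,\mu,\eta)$ in $(\mathcal C,\otimes,1)$. A GV-coalgebra is a counital coassociative coalgebra $(A,\Delta,\varepsilon)$ in $(\mathcal C,\odot,K)$, so $\Delta\colon A\to A\odot A$, $\varepsilon\colon A\to K$. A GV-Frobenius algebra is $(A,\mu,\eta,\Delta,\varepsilon)$ such that $(A,\mu,\eta)$ is an algebra, $(A,\Delta,\varepsilon)$ is a GV-coalgebra and $(\mu\odot\mathrm{id}_A)\circ\delta^{\mathrm l}_{A,A,A}\circ(\mathrm{id}_A\otimes\Delta)=\Delta\circ\mu=(\mathrm{id}_A\odot\mu)\circ\delta^{\mathrm r}_{A,A,A}\circ(\Delta\otimes\mathrm{id}_A)$ in $\mathrm{Hom}(A\otimes A,A\odot A)$.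 A morphism of GV-Frobenius algebras is a morphism in $\mathcal C$ compatible with $\mu,\eta,\Delta,\varepsilon$. A GV-pairing on $A$ is a morphism $\kappa\colon A\otimes A\to K$; it is invariant if $\kappa\circ(\mu\otimes\mathrm{id}_A)=\kappa\circ(\mathrm{id}_A\otimes\mu)$ (up to the associator), and non-degenerate if there is $\overline\kappa\colon1\to A\odot A$ with (up to unitors) $(\kappa\odot\mathrm{id}_A)\circ\delta^{\mathrm l}_{A,A,A}\circ(\mathrm{id}_A\otimes\overline\kappa)=\mathrm{id}_A=(\mathrm{id}_A\odot\kappa)\circ\delta^{\mathrm r}_{A,A,A}\circ(\overline\kappa\otimes\mathrm{id}_A)$. A Frobenius form on an algebra $A$ is a morphism $\lambda\colon A\to K$ such that the composite $A\cong A\otimes1\xrightarrow{\mathrm{id}\otimes\mathrm{coev}^{\mathrm r}_A}A\otimes(A\odot GA)\xrightarrow{\delta^{\mathrm l}_{A,A,GA}}(A\otimes A)\odot GA\xrightarrow{(\lambda\circ\mu)\odot\mathrm{id}}K\odot GA\cong GA$ is invertible.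
   Formalization: Categories 2 and 3 as described are not groupoids (e.g. the diagonal k → k×k preserves suitable forms and pairings), so in the equivalences with 1 only their invertible morphisms are taken; the equivalence of 2 and 3 with all morphisms is also proved. *)

(* Defs.v *)
From Stdlib Require Import ssreflect ssrfun ssrbool ProofIrrelevance.

Set Implicit Arguments.
Unset Strict Implicit.
Unset Printing Implicit Defensive.

(** * Categories *)

Record category : Type := Category {
  ob :> Type;
  hom : ob -> ob -> Type;
  idm : forall x, hom x x;
  comp : forall x y z, hom y z -> hom x y -> hom x z;
  comp1m : forall x y (f : hom x y), comp (idm y) f = f;
  compm1 : forall x y (f : hom x y), comp f (idm x) = f;
  compA : forall w x y z (h : hom y z) (g : hom x y) (f : hom w x),
    comp h (comp g f) = comp (comp h g) f }.

Arguments idm {c} x.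
Arguments comp {c x y z} g f : rename.
Notation "g ∘ f" := (comp g f) (at level 40, left associativity).

Definition op (C : category) : category :=
  @Category C (fun x y => hom y x) (fun x => idm x)
    (fun x y z g f => f ∘ g)
    (fun x y f => compm1 f) (fun x y f => comp1m f)
    (fun w x y z h g f => esym (compA f g h)).

Definition is_iso (C : category) (x y : C) (f : hom x y) : Prop :=
  exists g : hom y x, g ∘ f = idm x /\ f ∘ g = idm y.

Record iso (C : category) (x y : C) : Type := Iso {
  fwd :> hom x y;
  bwd : hom y x;
  isoK : bwd ∘ fwd = idm x;
  isoKV : fwd ∘ bwd = idm y }.

Definition iso_id (C : category) (x : C) : iso x x :=
  Iso (comp1m (idm x)) (comp1m (idm x)).

Definition iso_inv (C : category) (x y : C) (i : iso x y) : iso y x :=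
  Iso (isoKV i) (isoK i).

Lemma iso_compP (C : category) (x y z : C) (j : iso y z) (i : iso x y) :
  (bwd i ∘ bwd j) ∘ (j ∘ i) = idm x.
Proof. by rewrite -compA (compA (bwd j)) isoK comp1m isoK. Qed.

Definition iso_comp (C : category) (x y z : C) (j : iso y z) (i : iso x y) :
    iso x z :=
  Iso (iso_compP j i) (iso_compP (iso_inv i) (iso_inv j)).

Lemma iso_natural_bwd (C : category) (x y x' y' : C) (i : iso x y)
    (j : iso x' y') (f : hom x x') (g : hom y y') :
  j ∘ f = g ∘ i -> bwd j ∘ g = f ∘ bwd i.
Proof.
move=> e; rewrite -(compm1 g) -(isoKV i) !compA -(compA (bwd j)) -e.
by rewrite compA isoK comp1m.
Qed.

Definition is_groupoid (C : category) : Prop :=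
  forall (x y : C) (f : hom x y), is_iso f.

Record functor (C D : category) : Type := Functor {
  fob :> C -> D;
  fmap : forall x y, hom x y -> hom (fob x) (fob y);
  fmap1 : forall x, fmap (idm x) = idm (fob x);
  fmapM : forall x y z (g : hom y z) (f : hom x y),
    fmap (g ∘ f) = fmap g ∘ fmap f }.

Arguments fmap {C D} F {x y} f : rename.

Definition functor_id (C : category) : functor C C :=
  @Functor C C (fun x => x) (fun x y f => f)
    (fun x => erefl) (fun x y z g f => erefl).

Definition functor_comp (C D E : category) (F : functor D E) (G : functor C D) :
    functor C E :=
  @Functor C E (fun x => F (G x)) (fun x y f => fmap F (fmap G f))
    (fun x => etrans (congr1 (fmap F) (fmap1 G x)) (fmap1 F (G x)))
    (fun x y z g f => etrans (congr1 (fmap F) (fmapM G g f))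
                        (fmapM F (fmap G g) (fmap G f))).

Record nat_iso (C D : category) (F G : functor C D) : Type := NatIso {
  nat_at :> forall x, iso (F x) (G x);
  nat_natural : forall x y (f : hom x y),
    nat_at y ∘ fmap F f = fmap G f ∘ nat_at x }.

Definition equivalent (C D : category) : Prop :=
  exists (F : functor C D) (G : functor D C),
    inhabited (nat_iso (functor_comp G F) (functor_id C)) /\
    inhabited (nat_iso (functor_comp F G) (functor_id D)).

(* A chosen quasi-inverse of F.  Any quasi-inverse can be completed to such
   data; the second triangle identity follows from the first. *)
Record adj_equivalence (C D : category) (F : functor C D) : Type :=
  AdjEquivalence {
    qinv : functor D C;
    eq_unit : nat_iso (functor_id C) (functor_comp qinv F);
    eq_counit : nat_iso (functor_comp F qinv) (functor_id D);
    eq_triangle : forall x : C,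
      eq_counit (F x) ∘ fmap F (eq_unit x) = idm (F x) }.

(* Objects of C with extra structure, and the morphisms of C satisfying P. *)
Section StructuredCategory.
Variables (C : category) (O : Type) (u : O -> C).
Variable P : forall a b : O, hom (u a) (u b) -> Prop.
Hypothesis P1 : forall a, P (idm (u a)).
Hypothesis PM : forall a b c (g : hom (u b) (u c)) (f : hom (u a) (u b)),
  P g -> P f -> P (g ∘ f).

Let shom (a b : O) : Type := {f : hom (u a) (u b) | P f}.

Lemma shom_inj (a b : O) (f g : {f : hom (u a) (u b) | P f}) :
  proj1_sig f = proj1_sig g -> f = g.
Proof.
by case: f g => [f Pf] [g Pg] /= fg; subst g; rewrite (proof_irrelevance _ Pf Pg).
Qed.

Definition structured_category : category.
Proof.
refine (@Category O shom (fun a => exist _ _ (P1 a))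
  (fun a b c g f => exist _ _ (PM (proj2_sig g) (proj2_sig f))) _ _ _).
- by move=> a b f; apply: shom_inj; apply: comp1m.
- by move=> a b f; apply: shom_inj; apply: compm1.
- by move=> a b c d h g f; apply: shom_inj; apply: compA.
Defined.
End StructuredCategory.

Lemma is_iso_id (C : category) (x : C) : is_iso (idm x).
Proof. by exists (idm x); rewrite comp1m. Qed.

Lemma is_iso_comp (C : category) (x y z : C) (g : hom y z) (f : hom x y) :
  is_iso g -> is_iso f -> is_iso (g ∘ f).
Proof.
move=> [g' [g'g gg']] [f' [f'f ff']]; exists (f' ∘ g'); split.
  by rewrite -compA (compA g') g'g comp1m.
by rewrite -compA (compA f) ff' comp1m.
Qed.

(* The maximal subgroupoid.  It is needed because an algebra morphism that
   preserves a pairing or a form need not be invertible: over a field k, take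
   the diagonal k -> k * k, with the identity as form on k and
   (a, b) |-> t * a + (1 - t) * b, t <> 0, 1, as form on k * k. *)
Definition core (C : category) : category :=
  structured_category (u := fun x : C => x) (P := fun x y f => is_iso f)
    (@is_iso_id C) (fun x y z g f => @is_iso_comp C x y z g f).

(** * Monoidal categories, algebras and coalgebras *)

Record monoidal (C : category) : Type := Monoidal {
  tens : C -> C -> C;
  tensm : forall x x' y y' : C, hom x x' -> hom y y' ->
    hom (tens x y) (tens x' y');
  tensm1 : forall x y, tensm (idm x) (idm y) = idm (tens x y);
  tensmM : forall (x x' x'' y y' y'' : C) (f' : hom x' x'') (f : hom x x')
    (g' : hom y' y'') (g : hom y y'),
    tensm (f' ∘ f) (g' ∘ g) = tensm f' g' ∘ tensm f g;
  munit : C;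
  assoc : forall x y z, iso (tens (tens x y) z) (tens x (tens y z));
  lunit : forall x, iso (tens munit x) x;
  runit : forall x, iso (tens x munit) x;
  assoc_natural : forall (x x' y y' z z' : C)
    (f : hom x x') (g : hom y y') (h : hom z z'),
    assoc x' y' z' ∘ tensm (tensm f g) h = tensm f (tensm g h) ∘ assoc x y z;
  lunit_natural : forall (x x' : C) (f : hom x x'),
    lunit x' ∘ tensm (idm munit) f = f ∘ lunit x;
  runit_natural : forall (x x' : C) (f : hom x x'),
    runit x' ∘ tensm f (idm munit) = f ∘ runit x;
  triangle : forall x y,
    tensm (idm x) (lunit y) ∘ assoc x munit y = tensm (runit x) (idm y);
  pentagon : forall w x y z,
    assoc w x (tens y z) ∘ assoc (tens w x) y z =
    tensm (idm w) (assoc x y z) ∘ assoc w (tens x y) z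
      ∘ tensm (assoc w x y) (idm z) }.

Section Algebras.
Variables (C : category) (M : monoidal C).
Local Notation "x ⊗ y" := (tens M x y) (at level 35, right associativity).
Local Notation "f ⊗' g" := (tensm M f g) (at level 35, right associativity).

Record is_algebra (A : C) (mu : hom (A ⊗ A) A) (eta : hom (munit M) A) : Prop :=
  IsAlgebra {
    mulA : mu ∘ (mu ⊗' idm A) = mu ∘ (idm A ⊗' mu) ∘ assoc M A A A;
    mul1 : mu ∘ (eta ⊗' idm A) = lunit M A;
    mulr1 : mu ∘ (idm A ⊗' eta) = runit M A }.

Record is_coalgebra (A : C) (Delta : hom A (A ⊗ A)) (eps : hom A (munit M)) :
    Prop := IsCoalgebra {
  comulA : assoc M A A A ∘ (Delta ⊗' idm A) ∘ Delta = (idm A ⊗' Delta) ∘ Delta;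
  counitl : lunit M A ∘ (eps ⊗' idm A) ∘ Delta = idm A;
  counitr : runit M A ∘ (idm A ⊗' eps) ∘ Delta = idm A }.

Record algebra : Type := Algebra {
  carrier :> C;
  mul : hom (carrier ⊗ carrier) carrier;
  one : hom (munit M) carrier;
  algebraP : is_algebra mul one }.

Definition is_algebra_morphism (A B : algebra) (f : hom A B) : Prop :=
  f ∘ mul A = mul B ∘ (f ⊗' f) /\ f ∘ one A = one B.

Lemma is_algebra_morphism_id (A : algebra) : is_algebra_morphism (idm A).
Proof. by split; rewrite ?tensm1 comp1m ?compm1. Qed.

Lemma is_algebra_morphism_comp (A B D : algebra) (g : hom B D) (f : hom A B) :
  is_algebra_morphism g -> is_algebra_morphism f -> is_algebra_morphism (g ∘ f).
Proof.
move=> [gM g1] [fM f1]; split; last by rewrite -compA f1.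
by rewrite -compA fM compA gM tensmM compA.
Qed.
End Algebras.

(** * Grothendieck-Verdier categories *)

Section Dualizing.
Variables (C : category) (M : monoidal C).
Local Notation "x ⊗ y" := (tens M x y) (at level 35, right associativity).
Local Notation "f ⊗' g" := (tensm M f g) (at level 35, right associativity).

(* [dual y] represents x |-> hom (x ⊗ y) K. *)
Record dual_structure (K : C) : Type := DualStructure {
  dual : C -> C;
  curry : forall x y, hom (x ⊗ y) K -> hom x (dual y);
  uncurry : forall x y, hom x (dual y) -> hom (x ⊗ y) K;
  curryK : forall x y (h : hom (x ⊗ y) K), uncurry (curry h) = h;
  uncurryK : forall x y (g : hom x (dual y)), curry (uncurry g) = g;
  curry_natural : forall x x' y (h : hom (x ⊗ y) K) (f : hom x' x),
    curry (h ∘ (f ⊗' idm y)) = curry h ∘ f }.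

Arguments curry {K} d {x y} h.
Arguments uncurry {K} d {x y} g.

Variables (K : C) (D : dual_structure K).

(* The representing morphism of the pullback of the evaluation
   dual y' ⊗ y' -> K along f. *)
Definition dualm (y y' : C) (f : hom y y') : hom (dual D y') (dual D y) :=
  curry D (uncurry D (idm (dual D y')) ∘ (idm (dual D y') ⊗' f)).

Lemma uncurry_natural x x' y (g : hom x (dual D y)) (f : hom x' x) :
  uncurry D (g ∘ f) = uncurry D g ∘ (f ⊗' idm y).
Proof. by rewrite -{1}(uncurryK g) -curry_natural curryK. Qed.

Lemma dualm_curry x y y' (f : hom y y') (h : hom (x ⊗ y') K) :
  dualm f ∘ curry D h = curry D (h ∘ (idm x ⊗' f)).
Proof.
have eh : h = uncurry D (idm _) ∘ (curry D h ⊗' idm y').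
  by rewrite -uncurry_natural comp1m curryK.
rewrite /dualm -curry_natural [in RHS]eh; congr (curry D _).
by rewrite -!compA -!tensmM !comp1m !compm1.
Qed.

Lemma dualm1 y : dualm (idm y) = idm (dual D y).
Proof. by rewrite /dualm tensm1 compm1 uncurryK. Qed.

Lemma dualmM x y z (g : hom y z) (f : hom x y) :
  dualm (g ∘ f) = dualm f ∘ dualm g.
Proof.
by rewrite {3}/dualm dualm_curry /dualm -compA -tensmM comp1m.
Qed.

Definition dual_functor : functor (op C) C :=
  @Functor (op C) C (dual D) (fun x y f => dualm f) dualm1
    (fun x y z g f => dualmM f g).
End Dualizing.

Arguments curry {C M K} d {x y} h.
Arguments uncurry {C M K} d {x y} g.

Record gv_category : Type := GVCategory {
  gv_cat :> category;
  gv_tensor : monoidal gv_cat;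
  gv_K : gv_cat;
  gv_dual : dual_structure gv_tensor gv_K;
  gv_equiv : adj_equivalence (dual_functor gv_dual) }.

Section GV.
Variable C : gv_category.

Local Notation T := (gv_tensor C).
Local Notation D := (gv_dual C).
Local Notation K := (gv_K C).
Local Notation I := (munit (gv_tensor C)).
Local Notation G := (dual (gv_dual C)).
Local Notation Gm := (dualm (gv_dual C)).
Local Notation "x ⊗ y" := (tens T x y) (at level 35, right associativity).
Local Notation "f ⊗' g" := (tensm T f g) (at level 35, right associativity).

Definition dualinv (x : C) : C := qinv (gv_equiv C) x.
Definition dualinvm (x y : C) (f : hom x y) : hom (dualinv y) (dualinv x) :=
  fmap (qinv (gv_equiv C)) f.
Local Notation H := dualinv.
Local Notation Hm := dualinvm.

Definition dualK (x : C) : iso (G (H x)) x := eq_counit (gv_equiv C) x.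

(* The unit lives in the opposite category, which reverses its direction. *)
Definition dualinvK (x : C) : iso (H (G x)) x :=
  let i := eq_unit (gv_equiv C) x in
  @Iso C (H (G x)) x (fwd i) (bwd i) (isoKV i) (isoK i).

Lemma dualinvm1 x : Hm (idm x) = idm (H x).
Proof. exact: (fmap1 (qinv (gv_equiv C))). Qed.

Lemma dualinvmM x y z (g : hom y z) (f : hom x y) : Hm (g ∘ f) = Hm f ∘ Hm g.
Proof. exact: (fmapM (qinv (gv_equiv C))). Qed.

Lemma dualK_natural x y (f : hom x y) : dualK y ∘ Gm (Hm f) = f ∘ dualK x.
Proof. exact: (nat_natural (eq_counit (gv_equiv C)) f). Qed.

Lemma dualinvK_natural x y (f : hom x y) :
  dualinvK y ∘ Hm (Gm f) = f ∘ dualinvK x.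
Proof. by have := nat_natural (eq_unit (gv_equiv C)) (f : @hom (op C) y x) => /= <-. Qed.

Lemma dualK_triangle x : dualK (G x) ∘ Gm (dualinvK x) = idm (G x).
Proof. exact: (eq_triangle (gv_equiv C) x). Qed.

Definition iso_tens (x x' y y' : C) (i : iso x x') (j : iso y y') :
  iso (x ⊗ y) (x' ⊗ y').
Proof.
by refine (@Iso _ _ _ (i ⊗' j) (bwd i ⊗' bwd j) _ _);
  rewrite -tensmM ?isoK ?isoKV tensm1.
Defined.

Definition iso_dualinv (x y : C) (i : iso x y) : iso (H y) (H x).
Proof.
by refine (@Iso _ _ _ (Hm i) (Hm (bwd i)) _ _);
  rewrite -dualinvmM ?isoK ?isoKV dualinvm1.
Defined.

Lemma dualm_inj x y (f g : hom x y) : Gm f = Gm g -> f = g.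
Proof.
move=> fg; rewrite -(compm1 f) -(compm1 g) -(isoKV (dualinvK x)).
by rewrite !compA -!dualinvK_natural fg.
Qed.

(* The preimage under G of a morphism between objects in its image. *)
Definition undual (x y : C) (g : hom (G y) (G x)) : hom x y :=
  dualinvK y ∘ Hm g ∘ bwd (dualinvK x).

Lemma undualK x y (f : hom x y) : undual (Gm f) = f.
Proof. by rewrite /undual dualinvK_natural -compA isoKV compm1. Qed.

Lemma dualinvm_inj x y (f g : hom x y) : Hm f = Hm g -> f = g.
Proof.
move=> fg; rewrite -(compm1 f) -(compm1 g) -(isoKV (dualK x)).
by rewrite !compA -!dualK_natural fg.
Qed.

Lemma dualmK x y (g : hom (G y) (G x)) : Gm (undual g) = g.
Proof.
apply: dualinvm_inj.
have e z w (f : hom z w) : Hm (Gm f) = bwd (dualinvK w) ∘ f ∘ dualinvK z.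
  by rewrite -compA -dualinvK_natural compA isoK comp1m.
by rewrite e /undual !compA isoK comp1m -compA isoK compm1.
Qed.

(** ** The second tensor product *)

Definition odot (x y : C) : C := H (G y ⊗ G x).
Definition odotm (x x' y y' : C) (f : hom x x') (g : hom y y') :
  hom (odot x y) (odot x' y') := Hm (Gm g ⊗' Gm f).
Local Notation "x ⊙ y" := (odot x y) (at level 35, right associativity).
Local Notation "f ⊙' g" := (odotm f g) (at level 35, right associativity).

Definition odot_assoc (x y z : C) : iso ((x ⊙ y) ⊙ z) (x ⊙ (y ⊙ z)) :=
  iso_dualinv
    (iso_comp (iso_tens (iso_id (G z)) (iso_inv (dualK (G y ⊗ G x))))
    (iso_comp (assoc T (G z) (G y) (G x))
      (iso_tens (dualK (G z ⊗ G y)) (iso_id (G x))))).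

(* hom x K = hom (I ⊗ x) K = hom I (G x), whence K = G^-1 I, i.e. I = G K. *)
Definition unit_dual : hom I (G K) := curry D (lunit T K).

Definition unit_dual_inv : hom (G K) I :=
  dualK I ∘ Gm (uncurry D (bwd (dualK I)) ∘ bwd (lunit T (H I))).

Lemma dualm_unit_dual x (f : hom x K) :
  Gm f ∘ unit_dual = curry D (f ∘ lunit T x).
Proof. by rewrite /unit_dual dualm_curry lunit_natural. Qed.

Lemma unit_dualK : unit_dual_inv ∘ unit_dual = idm I.
Proof.
rewrite /unit_dual_inv -compA dualm_unit_dual -compA isoK compm1 uncurryK.
exact: isoKV.
Qed.

Lemma unit_dualKV : unit_dual ∘ unit_dual_inv = idm (G K).
Proof.
have [g eg] : exists g, Gm g = unit_dual ∘ unit_dual_inv.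
  by exists (undual (unit_dual ∘ unit_dual_inv)); rewrite dualmK.
have : Gm g ∘ unit_dual = Gm (idm K) ∘ unit_dual.
  by rewrite eg dualm1 comp1m -compA unit_dualK compm1.
rewrite !dualm_unit_dual => /(congr1 (@uncurry _ _ _ D _ _)).
rewrite !curryK => /(congr1 (fun h => h ∘ bwd (lunit T K))).
by rewrite -!compA !isoKV !compm1 => g1; rewrite -eg g1 dualm1.
Qed.

Definition iso_unit_dual : iso I (G K) := Iso unit_dualK unit_dualKV.

Definition odot_lunit (x : C) : iso (K ⊙ x) x :=
  iso_comp (dualinvK x)
    (iso_dualinv (iso_comp (iso_tens (iso_id (G x)) iso_unit_dual)
                           (iso_inv (runit T (G x))))).

Definition odot_runit (x : C) : iso (x ⊙ K) x :=
  iso_comp (dualinvK x)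
    (iso_dualinv (iso_comp (iso_tens iso_unit_dual (iso_id (G x)))
                           (iso_inv (lunit T (G x))))).

Lemma odotm1 x y : idm x ⊙' idm y = idm (x ⊙ y).
Proof. by rewrite /odotm !dualm1 tensm1 dualinvm1. Qed.

Lemma odotmM (x x' x'' y y' y'' : C) (f' : hom x' x'') (f : hom x x')
    (g' : hom y' y'') (g : hom y y') :
  (f' ∘ f) ⊙' (g' ∘ g) = (f' ⊙' g') ∘ (f ⊙' g).
Proof. by rewrite /odotm !dualmM tensmM dualinvmM. Qed.

Lemma tensmMl (x x' x'' y : C) (g : hom x' x'') (f : hom x x') :
  (g ∘ f) ⊗' idm y = (g ⊗' idm y) ∘ (f ⊗' idm y).
Proof. by rewrite -tensmM comp1m. Qed.

Lemma tensmMr (x y y' y'' : C) (g : hom y' y'') (f : hom y y') :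
  idm x ⊗' (g ∘ f) = (idm x ⊗' g) ∘ (idm x ⊗' f).
Proof. by rewrite -tensmM comp1m. Qed.

Lemma dualm_dualinvm x y (f : hom x y) :
  Gm (Hm f) = bwd (dualK y) ∘ f ∘ dualK x.
Proof. by rewrite -compA -dualK_natural compA isoK comp1m. Qed.

Lemma odot_assoc_natural (x x' y y' z z' : C)
    (f : hom x x') (g : hom y y') (h : hom z z') :
  odot_assoc x' y' z' ∘ ((f ⊙' g) ⊙' h) = (f ⊙' (g ⊙' h)) ∘ odot_assoc x y z.
Proof.
rewrite /= /odotm -!dualinvmM !dualm_dualinvm; congr (Hm _).
rewrite !compA -tensmM compm1 -(compA (bwd _ ∘ _)) isoKV compm1.
rewrite -[in RHS](compA _ (dualK _ ⊗' _)) -tensmM !compA isoKV !comp1m.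
rewrite -{1}(comp1m (Gm h)) tensmM -[in RHS](compm1 (Gm f)).
rewrite (tensmM _ (Gm h ⊗' Gm g) _ (Gm f)).
rewrite !compA -(compA _ (assoc T (G z) _ _)) assoc_natural.
by rewrite -!compA.
Qed.

Lemma odot_lunit_natural (x x' : C) (f : hom x x') :
  odot_lunit x' ∘ (idm K ⊙' f) = f ∘ odot_lunit x.
Proof.
rewrite /= /odotm [in RHS]compA -dualinvK_natural -!compA -!dualinvmM.
congr (_ ∘ Hm _).
rewrite dualm1 compA -tensmM comp1m compm1.
rewrite -[in RHS]compA.
have -> : bwd (runit T (G x)) ∘ Gm f
    = (Gm f ⊗' idm I) ∘ bwd (runit T (G x')).
  by apply: iso_natural_bwd; rewrite runit_natural.
by rewrite compA -tensmM comp1m compm1.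
Qed.

Lemma odot_runit_natural (x x' : C) (f : hom x x') :
  odot_runit x' ∘ (f ⊙' idm K) = f ∘ odot_runit x.
Proof.
rewrite /= /odotm [in RHS]compA -dualinvK_natural -!compA -!dualinvmM.
congr (_ ∘ Hm _).
rewrite dualm1 compA -tensmM comp1m compm1.
rewrite -[in RHS]compA.
have -> : bwd (lunit T (G x)) ∘ Gm f
    = (idm I ⊗' Gm f) ∘ bwd (lunit T (G x')).
  by apply: iso_natural_bwd; rewrite lunit_natural.
by rewrite compA -tensmM comp1m compm1.
Qed.

Lemma dualm_dualinvK x : Gm (dualinvK x) = bwd (dualK (G x)).
Proof.
by rewrite -[LHS]comp1m -(isoK (dualK (G x))) -compA dualK_triangle compm1.
Qed.

Lemma dualm_dualinvKV x : Gm (bwd (dualinvK x)) = dualK (G x).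
Proof.
rewrite -[LHS]compm1 -(isoK (dualK (G x))) compA -dualm_dualinvK.
by rewrite -dualmM isoKV dualm1 comp1m.
Qed.

Lemma odot_triangle (x y : C) :
  (idm x ⊙' odot_lunit y) ∘ odot_assoc x K y = odot_runit x ⊙' idm y.
Proof.
rewrite /= /odotm -!dualinvmM !dualmM !dualm_dualinvm !dualm_dualinvK.
congr (Hm _); rewrite !dualm1.
rewrite -![_ ∘ dualK _ ∘ bwd _]compA !isoKV !compm1.
rewrite -!compA -tensmM comp1m !compA isoKV comp1m.
rewrite -!compA -[in LHS](comp1m (idm (G x))) tensmM !compA.
rewrite -(compA (idm _ ⊗' _)) assoc_natural !compA -tensmM comp1m -compA.
have -> : assoc T (G y) I (G x) ∘ (bwd (runit T (G y)) ⊗' idm (G x))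
    = idm (G y) ⊗' bwd (lunit T (G x)).
  have e := @iso_natural_bwd _ _ _ _ _
    (iso_tens (runit T (G y)) (iso_id (G x)))
    (iso_tens (iso_id (G y)) (lunit T (G x))) (assoc T _ _ _) (idm _).
  by rewrite -[RHS]compm1; apply/esym/e; rewrite comp1m /= triangle.
by rewrite -tensmM comp1m.
Qed.

Lemma odot_pentagon (w x y z : C) :
  odot_assoc w x (y ⊙ z) ∘ odot_assoc (w ⊙ x) y z =
  (idm w ⊙' odot_assoc x y z) ∘ odot_assoc w (x ⊙ y) z
    ∘ (odot_assoc w x y ⊙' idm z).
Proof.
rewrite /= /odotm -!dualinvmM !dualm_dualinvm; congr (Hm _).
rewrite !dualm1 !tensmMr !tensmMl -!compA; congr (_ ∘ _).
rewrite (compA (idm _ ⊗' dualK (G (x ⊙ y) ⊗ G w))) -tensmMr isoKV tensm1 comp1m.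
have e p q (i : iso p q) r : (i ⊗' idm r) ∘ (bwd i ⊗' idm r) = idm (q ⊗ r).
  by rewrite -tensmMl isoKV tensm1.
rewrite (compA (dualK (G z ⊗ G (x ⊙ y)) ⊗' _)) e comp1m.
rewrite !compA; congr (_ ∘ _).
rewrite -(compA _ (assoc T _ (G (x ⊙ y)) _)) assoc_natural.
have e' s p q (i : iso p q) r :
    (idm s ⊗' (i ⊗' idm r)) ∘ (idm s ⊗' (bwd i ⊗' idm r)) = idm (s ⊗ (q ⊗ r)).
  by rewrite -tensmMr e tensm1.
rewrite !compA -(compA _ (idm _ ⊗' (dualK _ ⊗' _)) (idm _ ⊗' _)) e' compm1.
have -> : assoc T (G z) (G y) (G (w ⊙ x)) ∘ (dualK (G z ⊗ G y) ⊗' idm _)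
      ∘ (idm _ ⊗' bwd (dualK (G x ⊗ G w)))
    = (idm _ ⊗' (idm _ ⊗' bwd (dualK (G x ⊗ G w)))) ∘ assoc T _ _ _
      ∘ (dualK (G z ⊗ G y) ⊗' (idm _ ⊗' idm _)).
  rewrite -assoc_natural -!compA -!tensmM tensm1 comp1m compm1.
  by rewrite !tensm1 comp1m compm1.
rewrite -!compA -assoc_natural; congr (_ ∘ _).
by rewrite !compA pentagon.
Qed.

Definition odot_monoidal : monoidal C :=
  @Monoidal C odot odotm odotm1 odotmM K odot_assoc odot_lunit odot_runit
    odot_assoc_natural odot_lunit_natural odot_runit_natural
    odot_triangle odot_pentagon.

(** ** Adjunctions and distributors *)

(* hom (a ⊗ b) c = hom (G c) (G (a ⊗ b)) = hom (G c ⊗ (a ⊗ b)) K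
   = hom ((G c ⊗ a) ⊗ b) K = hom (G c ⊗ a) (G b) = hom (G c ⊗ G (H a)) (G b)
   = hom b (H (G c ⊗ G (H a))). *)
Definition adj (a b c : C) (f : hom (a ⊗ b) c) : hom b (H a ⊙ c) :=
  Hm (curry D (uncurry D (Gm f) ∘ assoc T (G c) a b) ∘ (idm (G c) ⊗' dualK a))
    ∘ bwd (dualinvK b).

Definition adj_inv (a b c : C) (h : hom b (H a ⊙ c)) : hom (a ⊗ b) c :=
  undual (curry D
    (uncurry D (Gm h ∘ bwd (dualK _) ∘ (idm (G c) ⊗' bwd (dualK a)))
      ∘ bwd (assoc T (G c) a b))).

Lemma adjK a b c (f : hom (a ⊗ b) c) : adj_inv (adj f) = f.
Proof.
rewrite /adj_inv /adj; set g := curry D (uncurry D (Gm f) ∘ _).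
rewrite dualmM dualm_dualinvm dualm_dualinvKV.
rewrite !compA isoKV comp1m -(compA _ (dualK _)) isoKV compm1.
rewrite -(compA g) -tensmMr isoKV tensm1 compm1 /g curryK -compA isoKV compm1.
by rewrite uncurryK undualK.
Qed.

Lemma adj_invK a b c (h : hom b (H a ⊙ c)) : adj (adj_inv h) = h.
Proof.
rewrite /adj_inv /adj dualmK curryK -(compA (uncurry D _)) isoK compm1 uncurryK.
rewrite -(compA _ (idm _ ⊗' _)) -tensmMr isoK tensm1 compm1.
apply: dualm_inj; rewrite dualmM dualm_dualinvm dualm_dualinvKV.
by rewrite !compA isoKV comp1m -(compA (Gm h)) isoK compm1.
Qed.

(* The case a = G c of the adjunction, with H (G c) replaced by c. *)
Definition dual_adj (c b d : C) (f : hom (G c ⊗ b) d) : hom b (c ⊙ d) :=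
  (dualinvK c ⊙' idm d) ∘ adj f.

Definition dual_adj_inv (c b d : C) (h : hom b (c ⊙ d)) : hom (G c ⊗ b) d :=
  adj_inv ((bwd (dualinvK c) ⊙' idm d) ∘ h).

Definition ev (c y : C) : hom (G c ⊗ (c ⊙ y)) y := dual_adj_inv (idm (c ⊙ y)).

Definition coev (c y : C) : hom y (c ⊙ (G c ⊗ y)) := dual_adj (idm (G c ⊗ y)).

Definition coevr (c : C) : hom I (c ⊙ G c) :=
  (idm c ⊙' runit T (G c)) ∘ coev c I.

Definition distr (x y z : C) : hom ((x ⊙ y) ⊗ z) (x ⊙ (y ⊗ z)) :=
  dual_adj ((ev x y ⊗' idm z) ∘ bwd (assoc T (G x) (x ⊙ y) z)).

(* [coev (H x) y] has codomain H x ⊙ (G (H x) ⊗ y). *)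
Definition distl (x y z : C) : hom (x ⊗ (y ⊙ z)) ((x ⊗ y) ⊙ z) :=
  adj_inv (odot_assoc (H x) (x ⊗ y) z
    ∘ (((idm (H x) ⊙' (dualK x ⊗' idm y)) ∘ coev (H x) y) ⊙' idm z)).

(** ** GV-Frobenius algebras *)

Record gv_frobenius : Type := GVFrobenius {
  frob_algebra :> algebra T;
  comul : hom frob_algebra (frob_algebra ⊙ frob_algebra);
  counit : hom frob_algebra K;
  frob_coalgebraP : is_coalgebra (M := odot_monoidal) comul counit;
  frobeniusl :
    (mul frob_algebra ⊙' idm frob_algebra)
      ∘ distl frob_algebra frob_algebra frob_algebra
      ∘ (idm frob_algebra ⊗' comul) = comul ∘ mul frob_algebra;
  frobeniusr :
    comul ∘ mul frob_algebra =
    (idm frob_algebra ⊙' mul frob_algebra)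
      ∘ distr frob_algebra frob_algebra frob_algebra
      ∘ (comul ⊗' idm frob_algebra) }.

Definition is_frobenius_morphism (A B : gv_frobenius) (f : hom A B) : Prop :=
  [/\ is_algebra_morphism f, comul B ∘ f = (f ⊙' f) ∘ comul A
    & counit B ∘ f = counit A].

Lemma is_frobenius_morphism_id (A : gv_frobenius) :
  is_frobenius_morphism (A := A) (B := A) (idm A).
Proof.
split; first exact: is_algebra_morphism_id.
- by rewrite odotm1 compm1 comp1m.
- exact: compm1.
Qed.

Lemma is_frobenius_morphism_comp (A B E : gv_frobenius)
    (g : hom B E) (f : hom A B) :
  is_frobenius_morphism g -> is_frobenius_morphism f ->
  is_frobenius_morphism (A := A) (B := E) (g ∘ f).
Proof.
move=> [gA gD ge] [fA fD fe]; split; first exact: is_algebra_morphism_comp.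
- by rewrite compA gD -compA fD compA odotmM.
- by rewrite compA ge.
Qed.

Definition frobenius_category : category :=
  structured_category is_frobenius_morphism_id is_frobenius_morphism_comp.

(** ** Invariant non-degenerate pairings *)

Definition is_invariant (A : algebra T) (kappa : hom (A ⊗ A) K) : Prop :=
  kappa ∘ (mul A ⊗' idm A) = kappa ∘ (idm A ⊗' mul A) ∘ assoc T A A A.

Definition is_nondegenerate (A : C) (kappa : hom (A ⊗ A) K) : Prop :=
  exists kappabar : hom I (A ⊙ A),
    odot_lunit A ∘ (kappa ⊙' idm A) ∘ distl A A A ∘ (idm A ⊗' kappabar)
      ∘ bwd (runit T A) = idm A /\
    odot_runit A ∘ (idm A ⊙' kappa) ∘ distr A A A ∘ (kappabar ⊗' idm A)
      ∘ bwd (lunit T A) = idm A.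

Record pairing_algebra : Type := PairingAlgebra {
  pairing_algebra_algebra :> algebra T;
  pairing : hom (pairing_algebra_algebra ⊗ pairing_algebra_algebra) K;
  pairing_invariant : is_invariant pairing;
  pairing_nondegenerate : is_nondegenerate pairing }.

Definition is_pairing_morphism (A B : pairing_algebra) (f : hom A B) : Prop :=
  is_algebra_morphism f /\ pairing B ∘ (f ⊗' f) = pairing A.

Lemma is_pairing_morphism_id (A : pairing_algebra) :
  is_pairing_morphism (A := A) (B := A) (idm A).
Proof.
split; first exact: is_algebra_morphism_id.
by rewrite tensm1 compm1.
Qed.

Lemma is_pairing_morphism_comp (A B E : pairing_algebra)
    (g : hom B E) (f : hom A B) :
  is_pairing_morphism g -> is_pairing_morphism f ->
  is_pairing_morphism (A := A) (B := E) (g ∘ f).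
Proof.
move=> [gA gk] [fA fk]; split; first exact: is_algebra_morphism_comp.
by rewrite tensmM compA gk.
Qed.

Definition pairing_category : category :=
  structured_category is_pairing_morphism_id is_pairing_morphism_comp.

(** ** Frobenius forms *)

Definition form_map (A : algebra T) (lambda : hom A K) : hom A (G A) :=
  odot_lunit (G A) ∘ ((lambda ∘ mul A) ⊙' idm (G A)) ∘ distl A A (G A)
    ∘ (idm A ⊗' coevr A) ∘ bwd (runit T A).

Definition is_frobenius_form (A : algebra T) (lambda : hom A K) : Prop :=
  is_iso (form_map lambda).

Record form_algebra : Type := FormAlgebra {
  form_algebra_algebra :> algebra T;
  form : hom form_algebra_algebra K;
  form_frobenius : is_frobenius_form form }.

Definition is_form_morphism (A B : form_algebra) (f : hom A B) : Prop :=
  is_algebra_morphism f /\ form B ∘ f = form A.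

Lemma is_form_morphism_id (A : form_algebra) :
  is_form_morphism (A := A) (B := A) (idm A).
Proof. by split; [exact: is_algebra_morphism_id | rewrite compm1]. Qed.

Lemma is_form_morphism_comp (A B E : form_algebra)
    (g : hom B E) (f : hom A B) :
  is_form_morphism g -> is_form_morphism f ->
  is_form_morphism (A := A) (B := E) (g ∘ f).
Proof.
move=> [gA gl] [fA fl]; split; first exact: is_algebra_morphism_comp.
by rewrite compA gl.
Qed.

Definition form_category : category :=
  structured_category is_form_morphism_id is_form_morphism_comp.
End GV.

(* Main.v *)
From Stdlib Require Import ssreflect ssrfun ssrbool IndefiniteDescription.
Require Import Defs.

(** The theorem holds because each of the three structures on an algebra A
    amounts to an isomorphism phi : A -> G A of the form a |-> lambda (a -),
    for a form lambda : A -> K.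

    A morphism h : b -> x ⊙ y is the same as its mate G x ⊗ b -> y.  After
    transposition everything happens in the monoidal category (C, ⊗) with the
    evaluations G x ⊗ x -> K, and the distributors, the associator and the
    unitors of ⊙ become evaluations composed with associators and unitors of ⊗
    (mate_distr, mate_distl, mate_assoc, mate_lunit, mate_runit).  Below, <b, a>
    is the evaluation, b ◁ a the right action of A on G A, and formulas in
    elements stand for morphisms.

    Pairings.  A copairing 1 -> A ⊙ A is the same as a morphism psi : G A -> A.
    The two conditions of non-degeneracy say that psi is inverse to
    curry kappa : A -> G A (nondegenerateP), and the morphism in the definition
    of a Frobenius form is curry (lambda ∘ mu) (form_mapE).  Thus
    lambda |-> lambda ∘ mu and kappa |-> kappa (1, -) exchange Frobenius forms
    and invariant non-degenerate pairings, compatibly with morphisms.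

    GV-Frobenius algebras.  The mate of Delta is a morphism
    G A ⊗ A -> A, written b ▷ a.  The Frobenius laws become
    (b ▷ a) a' = b ▷ (a a') = (b ◁ a) ▷ a'.  Hence b ▷ a = psi (b) a with
    psi (b) = b ▷ 1, and the counit laws make psi inverse to the map phi given
    by lambda = eps (frobenius_mapP).  Conversely, if phi is invertible with
    inverse psi, then b ▷ a = psi (b) a satisfies all axioms
    (frobenius_of_form).  So Delta is determined by the algebra and eps.

    Morphisms.  Both phi and psi are natural for morphisms of GV-Frobenius
    algebras, which makes those invertible; and an isomorphism of algebras
    preserving the forms preserves psi, hence Delta.  The forgetful functors
    are therefore essentially surjective, faithful, and full on
    isomorphisms. *)

Set Implicit Arguments.
Unset Strict Implicit.
Unset Printing Implicit Defensive.

(** * Rewriting modulo associativity, and coherence *)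

Section Composition.
Variable C : category.

(** Lets an equation g ∘ f = k act inside a composite bracketed to the
    right. *)
Lemma reassoc (w x y z : C) (g : hom y z) (f : hom x y) (k : hom x z)
    (r : hom w x) :
  g ∘ f = k -> g ∘ (f ∘ r) = k ∘ r.
Proof. by move=> <-; rewrite compA. Qed.

Lemma isoKl (w x y : C) (i : iso x y) (f : hom w x) : bwd i ∘ (i ∘ f) = f.
Proof. by rewrite compA isoK comp1m. Qed.

Lemma isoKVl (w x y : C) (i : iso x y) (f : hom w y) : i ∘ (bwd i ∘ f) = f.
Proof. by rewrite compA isoKV comp1m. Qed.

Lemma iso_epi (x y z : C) (i : iso x y) (f g : hom y z) :
  f ∘ i = g ∘ i -> f = g.
Proof.
by move=> e; rewrite -(compm1 f) -(compm1 g) -(isoKV i) !compA e.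
Qed.

Lemma iso_transpose (x y z : C) (i : iso y z) (f : hom x y) (g : hom x z) :
  i ∘ f = g <-> f = bwd i ∘ g.
Proof. by split=> [<- | ->]; rewrite (isoKl, isoKVl). Qed.
End Composition.

Section Coherence.
Variables (C : category) (M : monoidal C).
Local Notation I := (munit M).
Local Notation "x ⊗ y" := (tens M x y) (at level 35, right associativity).
Local Notation "f ⊗' g" := (tensm M f g) (at level 35, right associativity).

Lemma tensm_l (x x' y y' : C) (f : hom x x') (g : hom y y') :
  (f ⊗' idm y') ∘ (idm x ⊗' g) = f ⊗' g.
Proof. by rewrite -tensmM comp1m compm1. Qed.

Lemma tensm_r (x x' y y' : C) (f : hom x x') (g : hom y y') :
  (idm x' ⊗' g) ∘ (f ⊗' idm y) = f ⊗' g.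
Proof. by rewrite -tensmM comp1m compm1. Qed.

Lemma tensm_compl (x x' x'' y : C) (g : hom x' x'') (f : hom x x') :
  (g ⊗' idm y) ∘ (f ⊗' idm y) = (g ∘ f) ⊗' idm y.
Proof. by rewrite -tensmM comp1m. Qed.

Lemma tensm_compr (x y y' y'' : C) (g : hom y' y'') (f : hom y y') :
  (idm x ⊗' g) ∘ (idm x ⊗' f) = idm x ⊗' (g ∘ f).
Proof. by rewrite -tensmM comp1m. Qed.

Lemma assoc_bwd_natural (x x' y y' z z' : C)
    (f : hom x x') (g : hom y y') (h : hom z z') :
  bwd (assoc M x' y' z') ∘ (f ⊗' (g ⊗' h)) =
  ((f ⊗' g) ⊗' h) ∘ bwd (assoc M x y z).
Proof. by apply: iso_natural_bwd; rewrite assoc_natural. Qed.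

(** I ⊗ - is naturally isomorphic to the identity functor, hence faithful. *)
Lemma tens_unit_inj (x y : C) (f g : hom x y) :
  idm I ⊗' f = idm I ⊗' g -> f = g.
Proof.
move=> e; apply: (iso_epi (i := lunit M x)).
by rewrite -!lunit_natural e.
Qed.

(** Kelly's coherence lemma.  The functor I ⊗ - is faithful, so it is enough
    to check the tensored equation, and that follows from the pentagon for
    I, I, x, y by rewriting both of its unit triangles. *)
Lemma lunit_tens (x y : C) :
  lunit M (x ⊗ y) ∘ assoc M I x y = lunit M x ⊗' idm y.
Proof.
apply: tens_unit_inj.
apply: (iso_epi (i := assoc M I (I ⊗ x) y)).
have inv : (assoc M I I x ⊗' idm y) ∘ (bwd (assoc M I I x) ⊗' idm y) = idm _.
  by rewrite tensm_compl isoKV tensm1.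
suff e : (idm I ⊗' (lunit M (x ⊗ y) ∘ assoc M I x y)) ∘ assoc M I (I ⊗ x) y
     ∘ (assoc M I I x ⊗' idm y)
   = (idm I ⊗' (lunit M x ⊗' idm y)) ∘ assoc M I (I ⊗ x) y
     ∘ (assoc M I I x ⊗' idm y).
  by rewrite -[LHS]compm1 -[RHS]compm1 -inv !compA e.
rewrite -tensm_compr -!compA (compA (idm I ⊗' assoc M _ _ _)) -pentagon.
rewrite compA triangle -tensm1 -assoc_natural.
by rewrite compA -assoc_natural -compA tensm_compl triangle.
Qed.

Lemma lunit_tens_bwd (x y : C) :
  (lunit M x ⊗' idm y) ∘ bwd (assoc M I x y) = lunit M (x ⊗ y).
Proof. by rewrite -lunit_tens -compA isoKV compm1. Qed.

Lemma triangle_bwd (x y : C) :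
  bwd (assoc M x I y) ∘ (idm x ⊗' bwd (lunit M y)) =
  bwd (runit M x) ⊗' idm y.
Proof.
rewrite -[LHS]comp1m -tensm1 -(isoK (runit M x)) -tensm_compl -triangle.
by rewrite -!compA isoKVl tensm_compr isoKV tensm1 compm1.
Qed.

Lemma lunit_bwd_natural (x y : C) (f : hom x y) :
  bwd (lunit M y) ∘ f = (idm I ⊗' f) ∘ bwd (lunit M x).
Proof. by apply: iso_natural_bwd; rewrite lunit_natural. Qed.

Lemma runit_bwd_natural (x y : C) (f : hom x y) :
  bwd (runit M y) ∘ f = (f ⊗' idm I) ∘ bwd (runit M x).
Proof. by apply: iso_natural_bwd; rewrite runit_natural. Qed.
End Coherence.

Arguments tensm_l {C M x x' y y'} f g.
Arguments tensm_r {C M x x' y y'} f g.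
Arguments tensm_compl {C M x x' x'' y} g f.
Arguments tensm_compr {C M x y y' y''} g f.
Arguments lunit_bwd_natural {C M x y} f.
Arguments runit_bwd_natural {C M x y} f.

(** * Transposing tensor morphisms to dual objects *)

Section Dual.
Variable C : gv_category.
Local Notation T := (gv_tensor C).
Local Notation D := (gv_dual C).
Local Notation K := (gv_K C).
Local Notation I := (munit (gv_tensor C)).
Local Notation G := (dual (gv_dual C)).
Local Notation Gm := (dualm (gv_dual C)).
Local Notation "x ⊗ y" := (tens T x y) (at level 35, right associativity).
Local Notation "f ⊗' g" := (tensm T f g) (at level 35, right associativity).
Local Notation "x ⊙ y" := (odot x y) (at level 35, right associativity).
Local Notation "f ⊙' g" := (odotm f g) (at level 35, right associativity).
Local Notation α := (assoc T).

Definition eval (x : C) : hom (G x ⊗ x) K := uncurry D (idm (G x)).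

Lemma uncurryE x y (g : hom x (G y)) : uncurry D g = eval y ∘ (g ⊗' idm y).
Proof. by rewrite /eval -uncurry_natural comp1m. Qed.

Lemma eval_curry x y (h : hom (x ⊗ y) K) : eval y ∘ (curry D h ⊗' idm y) = h.
Proof. by rewrite -uncurryE curryK. Qed.

Lemma curry_eval x y (g : hom x (G y)) : curry D (eval y ∘ (g ⊗' idm y)) = g.
Proof. by rewrite -uncurryE uncurryK. Qed.

(** In terms of elements, b ◁ a in G y is the functional sending c to
    <b, f (a, c)>.  For f the multiplication of an algebra A this is the right
    action of A on G A. *)
Definition ract (x y z : C) (f : hom (x ⊗ y) z) : hom (G z ⊗ x) (G y) :=
  curry D (eval z ∘ (idm (G z) ⊗' f) ∘ α (G z) x y).

Lemma ract_eval x y z (f : hom (x ⊗ y) z) :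
  eval y ∘ (ract f ⊗' idm y) = eval z ∘ (idm (G z) ⊗' f) ∘ α (G z) x y.
Proof. exact: eval_curry. Qed.

(** G is faithful, so a morphism is determined by its pairings with the
    dual of its target. *)
Lemma ract_inj x y z (f g : hom (x ⊗ y) z) : ract f = ract g -> f = g.
Proof.
move=> /(congr1 (fun k => eval y ∘ (k ⊗' idm y))); rewrite !ract_eval.
move=> /iso_epi /(congr1 (@curry _ _ _ D _ _)) e.
by apply: dualm_inj.
Qed.

Lemma ract_natural_l x y z z' (f : hom (x ⊗ y) z) (g : hom z z') :
  ract (g ∘ f) = ract f ∘ (Gm g ⊗' idm x).
Proof.
rewrite /ract -curry_natural; congr (curry D _).
rewrite -!compA assoc_natural tensm1 (reassoc _ (tensm_r _ _)).
rewrite -(tensm_l (Gm g) f) !compA; congr (_ ∘ _).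
by rewrite /dualm eval_curry -compA tensm_compr.
Qed.

Lemma ract_natural_r x y y' z (f : hom (x ⊗ y) z) (g : hom y' y) :
  ract (f ∘ (idm x ⊗' g)) = Gm g ∘ ract f.
Proof.
rewrite /ract dualm_curry -tensm1; congr (curry D _).
by rewrite -!compA assoc_natural (reassoc _ (tensm_compr _ _)).
Qed.

Lemma ract_natural_m x x' y z (f : hom (x ⊗ y) z) (g : hom x' x) :
  ract (f ∘ (g ⊗' idm y)) = ract f ∘ (idm (G z) ⊗' g).
Proof.
rewrite /ract -curry_natural; congr (curry D _).
by rewrite -!compA assoc_natural (reassoc _ (tensm_compr _ _)).
Qed.

(** If h is a pairing, both sides send (b, a) to the functional
    c |-> h (b, f (a, c)). *)
Lemma ract_curry x y z w (f : hom (x ⊗ y) z) (h : hom (w ⊗ z) K) :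
  ract f ∘ (curry D h ⊗' idm x) = curry D (h ∘ (idm w ⊗' f) ∘ α w x y).
Proof.
rewrite /ract -curry_natural; congr (curry D _).
rewrite -!compA assoc_natural tensm1 (reassoc _ (tensm_r _ _)).
by rewrite -(tensm_l (curry D h)) !compA eval_curry.
Qed.

(** For f an evaluation this compares the associator of ⊙ with that of ⊗; the
    pentagon is what makes the two sides agree. *)
Lemma ract_comp x y z w v (f : hom (x ⊗ v) z) (g : hom (y ⊗ w) v) :
  ract (f ∘ (idm x ⊗' g) ∘ α x y w) =
  ract g ∘ (ract f ⊗' idm y) ∘ bwd (α (G z) x y).
Proof.
rewrite {3}/ract ract_curry -curry_natural {1}/ract; congr (curry D _).
rewrite -!compA -!tensm_compr -!compA; congr (_ ∘ (_ ∘ _)).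
rewrite -tensm1 (reassoc _ (assoc_natural _ _ _ _)) -!compA.
congr (_ ∘ _).
by rewrite (compA (α (G z) x _)) pentagon -!compA tensm_compl isoKV tensm1
  compm1.
Qed.

(** * Mates: morphisms into x ⊙ y as morphisms out of G x ⊗ - *)

Fact mate_key : unit. Proof. exact: tt. Qed.

(** The transpose of h under the adjunction between G c ⊗ - and c ⊙ -.  It is
    locked because its unfolding is a composite, into which rewriting with
    associativity would otherwise descend. *)
Definition mate (c b d : C) (h : hom b (c ⊙ d)) : hom (G c ⊗ b) d :=
  locked_with mate_key (@dual_adj_inv C c b d h).

Lemma mateE c b d (h : hom b (c ⊙ d)) : mate h = @dual_adj_inv C c b d h.
Proof. by rewrite /mate unlock. Qed.

Lemma mateK c b d (f : hom (G c ⊗ b) d) : mate (@dual_adj C c b d f) = f.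
Proof.
rewrite mateE /dual_adj_inv /dual_adj compA -odotmM isoK comp1m odotm1 comp1m.
exact: adjK.
Qed.

Lemma mate_inj c b d (h k : hom b (c ⊙ d)) : mate h = mate k -> h = k.
Proof.
have mate_invK (l : hom b (c ⊙ d)) : @dual_adj C c b d (mate l) = l.
  rewrite mateE /dual_adj_inv /dual_adj adj_invK compA -odotmM isoKV comp1m.
  by rewrite odotm1 comp1m.
by move=> e; rewrite -(mate_invK h) e mate_invK.
Qed.

Lemma ract_adj_inv a b c (h : hom b (dualinv a ⊙ c)) :
  ract (@adj_inv C a b c h) =
  Gm h ∘ bwd (dualK _) ∘ (idm (G c) ⊗' bwd (dualK a)).
Proof.
rewrite /ract /eval -(compA _ _ (α _ _ _)).
have -> : curry D (uncurry D (idm (G c)) ∘ ((idm (G c) ⊗' @adj_inv C a b c h)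
       ∘ α (G c) a b)) =
  curry D (uncurry D (Gm (@adj_inv C a b c h)) ∘ α (G c) a b).
  by rewrite /dualm curryK compA.
by rewrite /adj_inv dualmK curryK -compA isoK compm1 uncurryK.
Qed.

(** Since ract is injective, this characterizes the mate, and it replaces the
    definition of the adjunction in all that follows: to compute a mate, apply
    ract to both sides and compare morphisms between dual objects. *)
Lemma ract_mate c b d (h : hom b (c ⊙ d)) :
  ract (mate h) = Gm h ∘ bwd (dualK (G d ⊗ G c)).
Proof.
rewrite mateE /dual_adj_inv ract_adj_inv.
rewrite dualmM /odotm dualm_dualinvm dualm_dualinvKV dualm1.
rewrite -!compA; congr (_ ∘ _).
by rewrite isoKVl tensm_compr isoKV tensm1 compm1.
Qed.

Lemma mate_comp c b b' d (h : hom b (c ⊙ d)) (k : hom b' b) :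
  mate (h ∘ k) = mate h ∘ (idm (G c) ⊗' k).
Proof. by apply: ract_inj; rewrite ract_natural_r !ract_mate dualmM compA. Qed.

Lemma mate_odotm c c' b d d' (f : hom c c') (g : hom d d')
    (h : hom b (c ⊙ d)) :
  mate ((f ⊙' g) ∘ h) = g ∘ mate h ∘ (Gm f ⊗' idm b).
Proof.
apply: ract_inj; rewrite ract_natural_m ract_natural_l !ract_mate.
rewrite dualmM dualm_dualinvm -!compA; congr (_ ∘ (_ ∘ _)).
by rewrite isoKV compm1 tensm_l.
Qed.

(** mate (idm (c ⊙ d)) is the evaluation G c ⊗ (c ⊙ d) -> d. *)
Lemma mate_ev c b d (h : hom b (c ⊙ d)) :
  mate h = mate (idm (c ⊙ d)) ∘ (idm (G c) ⊗' h).
Proof. by rewrite -mate_comp comp1m. Qed.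

Lemma mate_lunit x :
  mate (bwd (odot_lunit x)) = lunit T x ∘ (unit_dual_inv C ⊗' idm x).
Proof.
apply: ract_inj; rewrite ract_mate ract_natural_m /=.
rewrite dualmM dualm_dualinvm dualm_dualinvKV -!compA isoKV compm1 isoKVl.
congr (_ ∘ _).
by rewrite -[LHS]curry_eval /ract -compA triangle.
Qed.

(** Under I ≅ G K, evaluation at K is the unitor, as unit_dual transposes it. *)
Lemma eval_K : eval K = lunit T K ∘ (unit_dual_inv C ⊗' idm K).
Proof.
rewrite -[LHS]compm1 -tensm1 -unit_dualKV -tensm_compl compA.
by rewrite eval_curry.
Qed.

(** By eval_K, pairing G K with the value of an evaluation at x only adds the
    unitor of G x ⊗ x, and lunit_tens moves that unitor to G x. *)
Lemma mate_runit x : mate (bwd (odot_runit x)) = eval x.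
Proof.
apply: ract_inj; rewrite ract_mate /=.
rewrite dualmM dualm_dualinvm dualm_dualinvKV -!compA isoKV compm1 isoKVl.
rewrite -[LHS]curry_eval /ract eval_K; congr (curry D _).
rewrite -!compA (reassoc _ (tensm_l _ _)) -(tensm_r _ (eval x)) -!compA.
rewrite -tensm1 -assoc_natural compA lunit_natural -!compA.
by rewrite (compA (lunit T _)) lunit_tens tensm_compl.
Qed.

(** An element of (x ⊙ y) ⊙ z is paired with a dual of x and then with a dual
    of y, or at once with their product, which lies in the dual of x ⊙ y. *)
Lemma mate_assoc x y z w (h : hom w ((x ⊙ y) ⊙ z)) :
  mate (mate (odot_assoc x y z ∘ h)) =
  mate h ∘ (bwd (dualK (G y ⊗ G x)) ⊗' idm w) ∘ bwd (α (G y) (G x) w).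
Proof.
apply: (iso_epi (i := α _ _ _)).
rewrite -(compA _ (bwd _)) isoK compm1 mate_ev.
apply: ract_inj.
rewrite ract_comp ract_natural_m !ract_mate.
rewrite dualm1 comp1m dualmM dualm_dualinvm /= -!compA; congr (_ ∘ (_ ∘ _)).
rewrite isoKVl (compA (dualK _ ⊗' _)) tensm_compl isoKV tensm1 comp1m isoKV.
exact: compm1.
Qed.

Lemma mate_distr x y z :
  mate (distr x y z) =
  (mate (idm (x ⊙ y)) ⊗' idm z) ∘ bwd (α (G x) (x ⊙ y) z).
Proof. by rewrite mateK mateE. Qed.

Lemma adj_inv_mate a b c (h : hom b (dualinv a ⊙ c)) :
  @adj_inv C a b c h = mate h ∘ (bwd (dualK a) ⊗' idm b).
Proof. by apply: ract_inj; rewrite ract_natural_m ract_mate ract_adj_inv. Qed.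

(** The left distributor evaluates a functional b on x ⊗ y against
    a ⊗ t, with t in y ⊙ z, by first moving a into the functional and then
    evaluating t on b ◁ a. *)
Lemma mate_distl x y z :
  mate (distl x y z) =
  mate (idm (y ⊙ z)) ∘ (ract (idm (x ⊗ y)) ⊗' idm (y ⊙ z))
    ∘ bwd (α (G (x ⊗ y)) x (y ⊙ z)).
Proof.
(* Only the mate of p matters; p itself is abstracted. *)
rewrite /distl; set p := (_ ∘ coev _ _).
have : mate p = dualK x ⊗' idm y.
  by rewrite mate_odotm mateK dualm1 tensm1 !compm1.
move: p => p mate_p.
rewrite adj_inv_mate mate_comp mate_assoc -!compA.
rewrite -[_ ⊙' idm z]compm1 mate_odotm comp1m.
rewrite assoc_bwd_natural -!compA; congr (_ ∘ _).
rewrite !compA !tensm_compl; congr ((_ ⊗' _) ∘ _).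
by rewrite -ract_mate -ract_natural_m mate_p tensm_compl isoKV tensm1.
Qed.

Lemma mate_distl_comp x w v z b (f : hom (x ⊗ w) v) (h : hom b (w ⊙ z)) :
  mate ((f ⊙' idm z) ∘ distl x w z ∘ (idm x ⊗' h)) =
  mate h ∘ (ract f ⊗' idm b) ∘ bwd (α (G v) x b).
Proof.
rewrite mate_comp mate_odotm mate_distl comp1m [mate h]mate_ev -!compA.
congr (_ ∘ _).
rewrite tensm_l assoc_bwd_natural (reassoc _ (tensm_r _ _)) compA -tensmM.
by rewrite comp1m -ract_natural_l compm1.
Qed.

Lemma mate_distr_comp x w v z b (f : hom (w ⊗ z) v) (h : hom b (x ⊙ w)) :
  mate ((idm x ⊙' f) ∘ distr x w z ∘ (h ⊗' idm z)) =
  f ∘ (mate h ⊗' idm z) ∘ bwd (α (G x) b z).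
Proof.
rewrite mate_comp mate_odotm mate_distr dualm1 tensm1 compm1 -!compA.
by rewrite assoc_bwd_natural (reassoc _ (tensm_compl _ _)) -mate_ev.
Qed.

(** * Non-degenerate pairings and Frobenius forms *)

Definition unit_mate (x y : C) (h : hom I (x ⊙ y)) : hom (G x) y :=
  mate h ∘ bwd (runit T (G x)).

Lemma curry_lunit x w (kappa : hom (x ⊗ w) K) :
  curry D (kappa ∘ lunit T (x ⊗ w) ∘ α I x w) = curry D kappa ∘ lunit T x.
Proof. by rewrite -curry_natural -compA lunit_tens. Qed.

(** A form on x, seen as a global element of the dual of x. *)
Definition form_point x (f : hom x K) : hom I (G x) := curry D (f ∘ lunit T x).

(** A morphism into K ⊙ y is tested by the single global element unit_dual of
    G K. *)
Lemma mate_lunitP b y (h : hom b (K ⊙ y)) (g : hom b y) :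
  h = bwd (odot_lunit y) ∘ g <->
  mate h ∘ (unit_dual C ⊗' idm b) = g ∘ lunit T b.
Proof.
have e : mate (bwd (odot_lunit y) ∘ g) ∘ (unit_dual C ⊗' idm b) = g ∘ lunit T b.
  rewrite mate_comp mate_lunit -!compA (reassoc _ (tensm_l _ _)) -tensm_r.
  by rewrite -!compA tensm_compl unit_dualK tensm1 compm1 lunit_natural.
split=> [-> //|eh]; apply: mate_inj.
apply: (iso_epi (i := iso_tens (iso_unit_dual C) (iso_id b))).
by rewrite /= eh e.
Qed.

Lemma ract_form_point x y z (f : hom (x ⊗ y) z) (g : hom z K) :
  ract f ∘ (form_point g ⊗' idm x) = curry D (g ∘ f) ∘ lunit T x.
Proof.
rewrite ract_curry -(compA g) lunit_natural compA; exact: curry_lunit.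
Qed.

(** The distributor moves a into kappa, which leaves the functional
    kappa (a, -) on w, and unit_mate h applies functionals on w to the first
    leg of h. *)
Lemma zigzag_left x w y (kappa : hom (x ⊗ w) K) (h : hom I (w ⊙ y)) :
  odot_lunit y ∘ (kappa ⊙' idm y) ∘ distl x w y ∘ (idm x ⊗' h)
    ∘ bwd (runit T x) = unit_mate h ∘ curry D kappa.
Proof.
set X := (kappa ⊙' idm y) ∘ distl x w y ∘ (idm x ⊗' h).
have eX : X ∘ bwd (runit T x) =
    bwd (odot_lunit y) ∘ (unit_mate h ∘ curry D kappa).
  apply/mate_lunitP; rewrite mate_comp mate_distl_comp -!compA tensm_r.
  rewrite -(tensm_l (unit_dual C)).
  rewrite -tensm1 (reassoc _ (assoc_bwd_natural _ _ _ _)) -!compA.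
  rewrite (reassoc _ (tensm_compl _ _)).
  have -> : unit_dual C = form_point (idm K) by rewrite /form_point comp1m.
  rewrite ract_form_point comp1m -tensm_compl -!compA.
  rewrite (reassoc _ (lunit_tens_bwd _ _ _)) lunit_natural.
  by rewrite (reassoc _ (esym (runit_bwd_natural _))) -!compA.
rewrite -[RHS](isoKVl (odot_lunit y)) -eX /X.
by move: (odot_lunit y) (distl x w y) => i d; rewrite !compA.
Qed.

(** By mate_runit the composite is determined by its pairings with b in G x,
    and those apply b to the first leg of h: they are the functionals
    kappa (unit_mate h b, -). *)
Lemma zigzag_right x w y (kappa : hom (w ⊗ y) K) (h : hom I (x ⊙ w))
    (f : hom y x) :
  odot_runit x ∘ (idm x ⊙' kappa) ∘ distr x w y ∘ (h ⊗' idm y)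
    ∘ bwd (lunit T y) = f <->
  curry D kappa ∘ unit_mate h = Gm f.
Proof.
set X := (idm x ⊙' kappa) ∘ distr x w y ∘ (h ⊗' idm y) ∘ bwd (lunit T y).
have -> : odot_runit x ∘ (idm x ⊙' kappa) ∘ distr x w y ∘ (h ⊗' idm y)
    ∘ bwd (lunit T y) = odot_runit x ∘ X.
  by rewrite /X; move: (odot_runit x) (distr x w y) => i d; rewrite !compA.
have mX : mate X = kappa ∘ (unit_mate h ⊗' idm y).
  rewrite /X mate_comp mate_distr_comp -!compA triangle_bwd.
  by rewrite tensm_compl.
have mR : mate (bwd (odot_runit x) ∘ f) = eval x ∘ (idm (G x) ⊗' f).
  by rewrite mate_comp mate_runit.
have -> : curry D kappa ∘ unit_mate h = curry D (mate X).
  by rewrite mX curry_natural.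
have -> : Gm f = curry D (mate (bwd (odot_runit x) ∘ f)) by rewrite mR.
split=> [<- | /(congr1 (@uncurry _ _ _ D _ _))]; first by rewrite isoKl.
by rewrite !curryK => /mate_inj ->; rewrite isoKVl.
Qed.

Lemma unit_mate_surj x y (psi : hom (G x) y) :
  exists h : hom I (x ⊙ y), unit_mate h = psi.
Proof.
exists (@dual_adj C x I y (psi ∘ runit T (G x))).
by rewrite /unit_mate mateK -compA isoKV compm1.
Qed.

(** The two zigzag identities say that unit_mate kappabar is a left and a right
    inverse of curry kappa, and every morphism G A -> A is of that form. *)
Lemma nondegenerateP (A : C) (kappa : hom (A ⊗ A) K) :
  is_nondegenerate kappa <-> is_iso (curry D kappa).
Proof.
split=> [[kappabar [el er]] | [psi [psiK Kpsi]]].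
  exists (unit_mate kappabar); split; first by rewrite -zigzag_left.
  by rewrite (iffLR (zigzag_right _ _ _) er) dualm1.
have [kappabar e] := unit_mate_surj psi; exists kappabar; split.
  by rewrite zigzag_left e.
by apply/zigzag_right; rewrite e Kpsi dualm1.
Qed.

Lemma unit_mate_coevr x : unit_mate (coevr x) = idm (G x).
Proof.
by rewrite /unit_mate mate_odotm mateK dualm1 tensm1 !compm1 isoKV.
Qed.

(** This is zigzag_left for the coevaluation, whose unit_mate is the identity
    of G A. *)
Lemma form_mapE (A : algebra T) (lambda : hom A K) :
  form_map lambda = curry D (lambda ∘ mul A).
Proof. by rewrite /form_map zigzag_left unit_mate_coevr comp1m. Qed.

(** * The axioms of a GV-Frobenius algebra in terms of the mate *)

(** In what follows mate Delta is written b ▷ a, for b in G A and a in A.  Left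
    counitality says eps ▷ a = a: moving eps across the mate turns it into
    the global element of G A that it represents. *)
Lemma counitlP (A : C) (Delta : hom A (A ⊙ A)) (eps : hom A K) :
  odot_lunit A ∘ (eps ⊙' idm A) ∘ Delta = idm A <->
  mate Delta ∘ (form_point eps ⊗' idm A) = lunit T A.
Proof.
have -> : mate Delta ∘ (form_point eps ⊗' idm A) = lunit T A <->
    (eps ⊙' idm A) ∘ Delta = bwd (odot_lunit A) ∘ idm A.
  rewrite mate_lunitP mate_odotm !comp1m -compA tensm_compl.
  by rewrite dualm_unit_dual.
by move: (odot_lunit A) => i; rewrite -iso_transpose compA.
Qed.

(** Right counitality says eps (b ▷ a) = <b, a>, since the right unitor of ⊙
    has the evaluation as mate. *)
Lemma counitrP (A : C) (Delta : hom A (A ⊙ A)) (eps : hom A K) :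
  odot_runit A ∘ (idm A ⊙' eps) ∘ Delta = idm A <->
  eps ∘ mate Delta = eval A.
Proof.
have -> : eps ∘ mate Delta = mate ((idm A ⊙' eps) ∘ Delta).
  by rewrite mate_odotm dualm1 tensm1 compm1.
rewrite -mate_runit -[bwd _]compm1.
have -> : odot_runit A ∘ (idm A ⊙' eps) ∘ Delta =
    odot_runit A ∘ ((idm A ⊙' eps) ∘ Delta).
  by move: (odot_runit A) => i; rewrite compA.
by rewrite iso_transpose; split=> [-> | /mate_inj].
Qed.

(** Coassociativity says (b' b) ▷ a = b' ▷ (b ▷ a).  The product of G A in
    this formula is ract (mate Delta), because by ract_mate that is, up to
    dualK, the image of Delta under G. *)
Lemma comulAP (A : C) (Delta : hom A (A ⊙ A)) :
  odot_assoc A A A ∘ (Delta ⊙' idm A) ∘ Delta = (idm A ⊙' Delta) ∘ Delta <->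
  mate Delta ∘ (ract (mate Delta) ⊗' idm A) =
  mate Delta ∘ (idm (G A) ⊗' mate Delta) ∘ α (G A) (G A) A.
Proof.
have l : mate (mate (odot_assoc A A A ∘ ((Delta ⊙' idm A) ∘ Delta))) =
    mate Delta ∘ (ract (mate Delta) ⊗' idm A) ∘ bwd (α (G A) (G A) A).
  rewrite mate_assoc mate_odotm comp1m ract_mate -!compA.
  by rewrite (reassoc _ (tensm_compl _ _)).
have r : mate (mate ((idm A ⊙' Delta) ∘ Delta)) =
    mate Delta ∘ (idm (G A) ⊗' mate Delta).
  by rewrite mate_odotm dualm1 tensm1 compm1 mate_comp.
have -> : odot_assoc A A A ∘ (Delta ⊙' idm A) ∘ Delta =
    odot_assoc A A A ∘ ((Delta ⊙' idm A) ∘ Delta).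
  by move: (odot_assoc A A A) => i; rewrite compA.
split=> e; first by rewrite -r -e l -compA isoK compm1.
by do 2!apply: mate_inj; rewrite l r e -compA isoKV compm1.
Qed.

(** The law (b ◁ a) ▷ a' = b ▷ (a a'): the left distributor moves a into the
    functional. *)
Lemma frobeniuslP (A : algebra T) (Delta : hom A (A ⊙ A)) :
  (mul A ⊙' idm A) ∘ distl A A A ∘ (idm A ⊗' Delta) = Delta ∘ mul A <->
  mate Delta ∘ (ract (mul A) ⊗' idm A) =
  mate Delta ∘ (idm (G A) ⊗' mul A) ∘ α (G A) A A.
Proof.
rewrite -mate_comp; split=> [<- | e].
  by rewrite mate_distl_comp -compA isoK compm1.
by apply: mate_inj; rewrite mate_distl_comp e -compA isoKV compm1.
Qed.

(** The law (b ▷ a) a' = b ▷ (a a'): the right distributor evaluates before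
    multiplying by a'. *)
Lemma frobeniusrP (A : algebra T) (Delta : hom A (A ⊙ A)) :
  Delta ∘ mul A = (idm A ⊙' mul A) ∘ distr A A A ∘ (Delta ⊗' idm A) <->
  mul A ∘ (mate Delta ⊗' idm A) =
  mate Delta ∘ (idm (G A) ⊗' mul A) ∘ α (G A) A A.
Proof.
rewrite -mate_comp; split=> [-> | e].
  by rewrite mate_distr_comp -compA isoK compm1.
by apply: mate_inj; rewrite mate_distr_comp e -compA isoKV compm1.
Qed.

(** * GV-Frobenius structures are Frobenius forms *)

Definition frobenius_map (A : gv_frobenius C) : hom A (G A) :=
  curry D (counit A ∘ mul A).

Definition frobenius_inv (A : gv_frobenius C) : hom (G A) A :=
  unit_mate (comul A ∘ one A).

(** With psi b = b ▷ 1, the right Frobenius law at a = 1 gives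
    b ▷ a = psi (b) a, hence eps (psi (b) a) = <b, a> by the right counit law:
    psi is a right inverse of the map a |-> eps (a -).  The left Frobenius law
    at b = eps gives (eps ◁ a) ▷ a' = a a', that is
    psi (eps ◁ a) a' = a a', and eps ◁ a is the functional eps (a -). *)
Lemma frobenius_mapP (A : gv_frobenius C) :
  [/\ mate (comul A) = mul A ∘ (frobenius_inv A ⊗' idm A),
      frobenius_inv A ∘ frobenius_map A = idm (A : C)
    & frobenius_map A ∘ frobenius_inv A = idm (G A)].
Proof.
rewrite /frobenius_map /frobenius_inv.
case: A => A Delta eps coalg frobl frobr /=.
have [unitl unitr] := (mul1 (algebraP A), mulr1 (algebraP A)).
move: frobl frobr => /frobeniuslP frobl /frobeniusrP frobr.
have /counitlP counitl := counitl coalg.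
have /counitrP counitr := counitr coalg.
set psi := unit_mate _.
have mate_mul : mate Delta = mul A ∘ (psi ⊗' idm A).
  rewrite /psi /unit_mate mate_comp -!tensm_compl compA compA frobr.
  rewrite -!compA (reassoc _ (assoc_natural _ _ _ _)) -!compA.
  rewrite (reassoc _ (tensm_compr _ _)) unitl compA -compA.
  rewrite (compA (_ ⊗' _) (α _ _ _)) triangle.
  by rewrite tensm_compl isoKV tensm1 compm1.
split=> //.
  (* psi (eps ◁ a) a' = a a', to be evaluated at a' = 1. *)
  have e : mul A ∘ ((psi ∘ curry D (eps ∘ mul A)) ⊗' idm A) = mul A.
    rewrite -tensm_compl compA -mate_mul.
    apply: (iso_epi (i := iso_tens (lunit T A) (iso_id A))) => /=.
    rewrite -compA tensm_compl -ract_form_point -tensm_compl compA frobl.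
    rewrite -!compA assoc_natural tensm1 (reassoc _ (tensm_r _ _)) -tensm_l.
    by rewrite !compA counitl lunit_natural -compA lunit_tens.
  apply: (iso_epi (i := runit T A)).
  rewrite -runit_natural comp1m -unitr -compA tensm_r.
  by rewrite -(tensm_l (psi ∘ _)) compA e.
by rewrite -curry_natural -compA -mate_mul counitr uncurryK.
Qed.

(** By frobenius_mapP the only candidate is b ▷ a = psi (b) a, with psi inverse
    to phi a = lambda (a -).  All axioms reduce to those of A once psi is
    known to be A-linear: psi (b ◁ a) = psi (b) a. *)
Lemma frobenius_of_form (A : algebra T) (lambda : hom A K) :
  is_iso (curry D (lambda ∘ mul A)) ->
  exists Delta : hom A (A ⊙ A),
  [/\ is_coalgebra (M := odot_monoidal C) Delta lambda,
      (mul A ⊙' idm A) ∘ distl A A A ∘ (idm A ⊗' Delta) = Delta ∘ mul A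
    & Delta ∘ mul A = (idm A ⊙' mul A) ∘ distr A A A ∘ (Delta ⊗' idm A)].
Proof.
set phi := curry D _ => -[psi [psiK phiK]].
pose Delta : hom A (A ⊙ A) := @dual_adj C A A A (mul A ∘ (psi ⊗' idm A)).
have mate_Delta : mate Delta = mul A ∘ (psi ⊗' idm A) by exact: mateK.
have mulA := mulA (algebraP A).
have psi_ract : psi ∘ ract (mul A) = mul A ∘ (psi ⊗' idm A).
  have phi_mul : phi ∘ mul A = ract (mul A) ∘ (phi ⊗' idm A).
    by rewrite ract_curry -curry_natural -!compA mulA -!compA.
  rewrite -[RHS]comp1m -{1}psiK -!compA (reassoc _ phi_mul) -!compA tensm_compl.
  by rewrite phiK tensm1 compm1.
have frobr : mul A ∘ (mate Delta ⊗' idm A) =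
    mate Delta ∘ (idm (G A) ⊗' mul A) ∘ α (G A) A A.
  rewrite mate_Delta -tensm_compl compA mulA -!compA assoc_natural tensm1.
  by rewrite (reassoc _ (tensm_r _ _)) (reassoc _ (tensm_l _ _)).
have frobl : mate Delta ∘ (ract (mul A) ⊗' idm A) =
    mate Delta ∘ (idm (G A) ⊗' mul A) ∘ α (G A) A A.
  by rewrite -frobr mate_Delta -compA tensm_compl psi_ract.
have counitr : lambda ∘ mate Delta = eval A.
  rewrite mate_Delta compA -(curryK D (lambda ∘ mul A)) -uncurry_natural.
  by rewrite phiK.
have counitl : mate Delta ∘ (form_point lambda ⊗' idm A) = lunit T A.
  have -> : form_point lambda = phi ∘ one A.
    by rewrite /phi -curry_natural -compA (mul1 (algebraP A)).
  rewrite mate_Delta -compA tensm_compl compA psiK comp1m.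
  exact: mul1 (algebraP A).
have comulA : mate Delta ∘ (ract (mate Delta) ⊗' idm A) =
    mate Delta ∘ (idm (G A) ⊗' mate Delta) ∘ α (G A) (G A) A.
  rewrite [in ract _]mate_Delta ract_natural_m -tensm_compl compA frobl.
  rewrite -!compA assoc_natural (reassoc _ (tensm_compr _ _)).
  by rewrite -mate_Delta.
exists Delta; split; last exact/frobeniusrP; last exact/frobeniuslP.
by split; [exact/comulAP | exact/counitlP | exact/counitrP].
Qed.
End Dual.

(** * Recognizing equivalences of categories *)

Definition faithful (C D : category) (F : functor C D) : Prop :=
  forall (x y : C) (f g : hom x y), fmap F f = fmap F g -> f = g.

Definition full (C D : category) (F : functor C D) : Prop :=
  forall (x y : C) (g : hom (F x) (F y)), exists f : hom x y, fmap F f = g.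

(** What fullness becomes for a functor corestricted to a maximal
    subgroupoid. *)
Definition full_on_isos (C D : category) (F : functor C D) : Prop :=
  forall (x y : C) (g : hom (F x) (F y)), is_iso g ->
  exists f : hom x y, fmap F f = g.

Definition essentially_surjective (C D : category) (F : functor C D) : Prop :=
  forall y : D, exists x : C, inhabited (iso (F x) y).

Lemma equivalent_of_fully_faithful (C D : category) (F : functor C D) :
  faithful F -> full F -> essentially_surjective F -> equivalent C D.
Proof.
move=> faithF fullF surjF.
(* Objects and morphisms are only known to exist, so a quasi-inverse needs
   choice; faithfulness makes the choice of morphisms functorial. *)
pose S y := sval (constructive_indefinite_description _ (surjF y)).
have iS y : inhabited (iso (F (S y)) y).
  exact: (svalP (constructive_indefinite_description _ (surjF y))).
pose i y : iso (F (S y)) y :=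
  sval (constructive_indefinite_description (fun _ => True)
    (match iS y with inhabits k => ex_intro _ k Logic.I end)).
pose L x y (g : hom (F x) (F y)) :=
  sval (constructive_indefinite_description _ (fullF x y g)).
have LK x y (g : hom (F x) (F y)) : fmap F (L _ _ g) = g.
  exact: (svalP (constructive_indefinite_description _ (fullF x y g))).
have L1 x : L _ _ (idm (F x)) = idm x by apply: faithF; rewrite LK fmap1.
have LM x y z (g : hom (F y) (F z)) (f : hom (F x) (F y)) :
  L _ _ (g ∘ f) = L _ _ g ∘ L _ _ f by apply: faithF; rewrite fmapM !LK.
pose Gm x y (f : hom x y) : hom (S x) (S y) := L _ _ (bwd (i y) ∘ f ∘ i x).
have Gm1 x : Gm x x (idm x) = idm (S x) by rewrite /Gm compm1 isoK L1.
have GmM x y z (g : hom y z) (f : hom x y) :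
  Gm x z (g ∘ f) = Gm y z g ∘ Gm x y f.
  by rewrite /Gm -LM -!compA isoKVl.
pose G := Functor Gm1 GmM.
exists F, G; split.
  have iK x : L _ _ (bwd (i (F x))) ∘ L _ _ (fwd (i (F x))) = idm (S (F x)).
    by rewrite -LM isoK L1.
  have iKV x : L _ _ (fwd (i (F x))) ∘ L _ _ (bwd (i (F x))) = idm x.
    by rewrite -LM isoKV L1.
  constructor.
  apply: (@NatIso _ _ (functor_comp G F) (functor_id C)
    (fun x => Iso (iK x) (iKV x))).
  move=> x y f /=; apply: faithF.
  by rewrite !fmapM !LK -compA isoKVl.
constructor; apply: (@NatIso _ _ (functor_comp F G) (functor_id D) i).
by move=> x y f /=; rewrite LK -compA isoKVl.
Qed.

Lemma equivalent_core (C D : category) (F : functor C D) :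
  is_groupoid C -> faithful F ->
  full_on_isos F -> essentially_surjective F -> equivalent C (core D).
Proof.
move=> gC faithF fullF surjF.
have isoF x y (f : hom x y) : is_iso (fmap F f).
  have [g [gf fg]] := gC x y f.
  by exists (fmap F g); rewrite -!fmapM gf fg !fmap1.
pose Fm (x y : C) (f : hom x y) : @hom (core D) (F x) (F y) :=
  exist _ (fmap F f) (isoF x y f).
have Fm1 x : Fm x x (idm x) = idm _ by apply: shom_inj; apply: fmap1.
have FmM x y z (g : hom y z) (f : hom x y) :
    Fm x z (g ∘ f) = Fm y z g ∘ Fm x y f.
  by apply: shom_inj; apply: fmapM.
apply: (@equivalent_of_fully_faithful _ _ (Functor Fm1 FmM)).
- by move=> x y f g /(congr1 (@proj1_sig _ _)) /faithF.
- move=> x y [g iso_g]; have [f e] := fullF x y g iso_g.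
  by exists f; apply: shom_inj.
- move=> y; have [x [i]] := surjF y; exists x; constructor.
  have iso_i : is_iso (fwd i) by exists (bwd i); rewrite isoK isoKV.
  have iso_bwd : is_iso (bwd i) by exists (fwd i); rewrite isoK isoKV.
  apply: (@Iso (core D) (F x) y (exist _ (fwd i) iso_i)
    (exist _ (bwd i) iso_bwd)).
    by apply: shom_inj; apply: isoK.
  by apply: shom_inj; apply: isoKV.
Qed.

Lemma faithful_comp (C D E : category) (F : functor D E) (G : functor C D) :
  faithful F -> faithful G -> faithful (functor_comp F G).
Proof. by move=> fF fG x y f g /= /fF /fG. Qed.

(** A fully faithful functor reflects isomorphisms, so an isomorphism can be
    lifted along F and then along G. *)
Lemma full_on_isos_comp (C D E : category) (F : functor D E) (G : functor C D) :
  faithful F -> full F -> full_on_isos G -> full_on_isos (functor_comp F G).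
Proof.
move=> faithF fullF fullG x y g [g' [g'g gg']] /=.
have [h eh] := fullF _ _ g; have [h' eh'] := fullF _ _ g'.
have iso_h : is_iso h.
  by exists h'; split; apply: faithF; rewrite fmapM eh eh' fmap1.
by have [f ef] := fullG _ _ h iso_h; exists f; rewrite ef.
Qed.

Lemma essentially_surjective_comp (C D E : category) (F : functor D E)
    (G : functor C D) :
  essentially_surjective F -> essentially_surjective G ->
  essentially_surjective (functor_comp F G).
Proof.
move=> sF sG z; have [y [j]] := sF z; have [x [i]] := sG y; exists x.
constructor; apply: (iso_comp j).
by apply: (@Iso _ _ _ (fmap F i) (fmap F (bwd i)));
  rewrite -fmapM ?isoK ?isoKV fmap1.
Qed.

Lemma equivalent_sym (C D : category) : equivalent C D -> equivalent D C.
Proof. by case=> F [G [GF FG]]; exists G, F. Qed.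

(** * The three groupoids *)

Section Algebras.
Variables (C : category) (M : monoidal C).

Lemma is_algebra_morphism_inv (A B : algebra M) (f : hom A B) (g : hom B A) :
  g ∘ f = idm A -> f ∘ g = idm B -> is_algebra_morphism f ->
  is_algebra_morphism g.
Proof.
move=> gf fg [fM f1]; split; last by rewrite -f1 compA gf comp1m.
rewrite -[LHS]compm1 -tensm1 -fg tensmM -!compA (compA (mul B)) -fM.
by rewrite !compA gf comp1m.
Qed.
End Algebras.

Section Categories.
Variable C : gv_category.
Local Notation T := (gv_tensor C).
Local Notation K := (gv_K C).
Local Notation D := (gv_dual C).
Local Notation G := (dual (gv_dual C)).
Local Notation Gm := (dualm (gv_dual C)).
Local Notation "x ⊗ y" := (tens T x y) (at level 35, right associativity).
Local Notation "f ⊗' g" := (tensm T f g) (at level 35, right associativity).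
Local Notation "x ⊙ y" := (odot x y) (at level 35, right associativity).
Local Notation "f ⊙' g" := (odotm f g) (at level 35, right associativity).

Lemma curry_pairing_morphism (A B : C) (kA : hom (A ⊗ A) K) (kB : hom (B ⊗ B) K)
    (f : hom A B) :
  kB ∘ (f ⊗' f) = kA -> curry D kA = Gm f ∘ curry D kB ∘ f.
Proof.
by move=> <-; rewrite dualm_curry -curry_natural -compA tensm_r.
Qed.

Lemma form_morphism_pairing (A B : algebra T) (lA : hom A K) (lB : hom B K)
    (f : hom A B) :
  is_algebra_morphism f -> lB ∘ f = lA ->
  (lB ∘ mul B) ∘ (f ⊗' f) = lA ∘ mul A.
Proof. by move=> [fM _] <-; rewrite -!compA fM. Qed.

(** frobenius_inv is the mate of the copairing Delta (1), which a morphism of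
    GV-Frobenius algebras preserves. *)
Lemma frobenius_inv_natural (A B : gv_frobenius C) (f : hom A B) :
  is_frobenius_morphism f -> frobenius_inv B = f ∘ frobenius_inv A ∘ Gm f.
Proof.
move=> [[_ f1] fD _]; rewrite /frobenius_inv /unit_mate -f1 compA fD -compA.
rewrite mate_odotm -!compA; congr (_ ∘ (_ ∘ _)).
by rewrite runit_bwd_natural.
Qed.

Lemma frobenius_map_natural (A B : gv_frobenius C) (f : hom A B) :
  is_algebra_morphism f -> counit B ∘ f = counit A ->
  frobenius_map A = Gm f ∘ frobenius_map B ∘ f.
Proof.
move=> fA fe; apply: curry_pairing_morphism; exact: form_morphism_pairing.
Qed.

(** For a morphism f : A -> B of GV-Frobenius algebras the two naturality
    equations make psi_A ∘ G f ∘ phi_B an inverse of f, where phi and psi are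
    frobenius_map and frobenius_inv. *)
Lemma frobenius_groupoid : is_groupoid (frobenius_category C).
Proof.
move=> A B [f Pf]; have [fA fD fe] := Pf.
have [g [gf fg]] : is_iso (f : hom (A : C) B).
  (* Abstracting the maps keeps rewriting from unfolding them. *)
  have := frobenius_map_natural fA fe; have := frobenius_inv_natural Pf.
  have [_ psiKA _] := frobenius_mapP A; have [_ psiKB _] := frobenius_mapP B.
  move: (frobenius_inv A) (frobenius_inv B) (frobenius_map A)
    (frobenius_map B) psiKA psiKB => psiA psiB phiA phiB psiKA psiKB epsi ephi.
  exists (psiA ∘ Gm f ∘ phiB).
  by rewrite -psiKA -psiKB ephi epsi !compA.
have Pg : is_frobenius_morphism (A := B) (B := A) g.
  split; first exact: is_algebra_morphism_inv gf fg fA.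
    rewrite -[LHS]comp1m -odotm1 -gf odotmM -!compA (compA (f ⊙' f)) -fD.
    by rewrite -!compA fg compm1.
  by rewrite -fe -compA fg compm1.
by exists (exist _ g Pg); split; apply: shom_inj.
Qed.

(** A form determines its comultiplication through the inverse psi of
    frobenius_map, and psi is natural along f as soon as f has a right
    inverse. *)
Lemma form_isomorphism_comul (A B : gv_frobenius C) (f : hom A B)
    (g : hom B A) :
  f ∘ g = idm (B : C) -> is_algebra_morphism f -> counit B ∘ f = counit A ->
  comul B ∘ f = (f ⊙' f) ∘ comul A.
Proof.
move=> fg fA fe.
have := frobenius_map_natural fA fe.
have [mA psiKA _] := frobenius_mapP A; have [mB _ phiKB] := frobenius_mapP B.
move: (frobenius_inv A) (frobenius_inv B) (frobenius_map A) (frobenius_map B)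
  mA psiKA mB phiKB => psiA psiB phiA phiB mA psiKA mB phiKB e.
have psi_f : f ∘ psiA ∘ Gm f = psiB.
  rewrite -[LHS]compm1 -phiKB -(compm1 phiB) -fg.
  by rewrite -!compA (compA phiB) (compA (Gm f)) (compA (Gm f)) -e
    (compA psiA) psiKA comp1m compA fg comp1m.
apply: mate_inj; rewrite mate_comp mate_odotm mA mB -psi_f.
rewrite compA fA.1 -!compA; congr (_ ∘ _).
by rewrite tensm_l tensm_compl -tensmM compm1.
Qed.

Lemma form_nondegenerate (A : form_algebra C) :
  is_nondegenerate (form A ∘ mul A).
Proof. apply/nondegenerateP; rewrite -form_mapE; exact: form_frobenius. Qed.

Lemma form_invariant (A : algebra T) (lambda : hom A K) :
  is_invariant (lambda ∘ mul A).
Proof. by rewrite /is_invariant -!compA (mulA (algebraP A)) -!compA. Qed.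

Definition form_pairing (A : form_algebra C) : pairing_algebra C :=
  PairingAlgebra (form_invariant (form A)) (form_nondegenerate A).

(** Invariance gives kappa (a, a') = kappa (1, a a'), so a pairing is
    determined by the form kappa (1, -). *)
Definition unit_form (A : algebra T) (kappa : hom (A ⊗ A) K) : hom A K :=
  kappa ∘ (one A ⊗' idm A) ∘ bwd (lunit T A).

Lemma unit_form_mul (A : algebra T) (lambda : hom A K) :
  unit_form (lambda ∘ mul A) = lambda.
Proof.
by rewrite /unit_form -!compA (compA (mul A)) (mul1 (algebraP A)) isoKV compm1.
Qed.

Lemma unit_formK (A : algebra T) (kappa : hom (A ⊗ A) K) :
  is_invariant kappa -> unit_form kappa ∘ mul A = kappa.
Proof.
move=> inv; rewrite /unit_form.
apply: (iso_epi (i := iso_tens (lunit T A) (iso_id A))) => /=.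
rewrite -!compA (reassoc _ (lunit_bwd_natural _)) -!compA -lunit_tens isoKl.
rewrite (reassoc _ (tensm_l _ _)) -tensm_r -!compA -tensm1 -assoc_natural.
by rewrite !compA -inv -!compA tensm_compl (mul1 (algebraP A)) lunit_tens.
Qed.

Lemma form_morphism_is_pairing_morphism (A B : form_algebra C) (f : hom A B) :
  is_form_morphism f ->
  is_pairing_morphism (A := form_pairing A) (B := form_pairing B) f.
Proof. by case=> fA fl; split=> //; apply: form_morphism_pairing. Qed.

Lemma pairing_morphism_is_form_morphism (A B : form_algebra C) (f : hom A B) :
  is_pairing_morphism (A := form_pairing A) (B := form_pairing B) f ->
  is_form_morphism f.
Proof.
case=> fA /= fl; split=> //.
rewrite -(unit_form_mul (form A)) -(unit_form_mul (form B)) -fl /unit_form.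
rewrite -!compA; congr (_ ∘ (_ ∘ _)).
rewrite lunit_bwd_natural -fA.2 !compA; congr (_ ∘ _).
by rewrite -!tensmM !comp1m !compm1.
Qed.

Definition form_to_pairing : functor (form_category C) (pairing_category C).
Proof.
refine (@Functor (form_category C) (pairing_category C) form_pairing
  (fun A B f => exist _ (proj1_sig f)
    (form_morphism_is_pairing_morphism (proj2_sig f))) _ _).
- by move=> A; apply: shom_inj.
- by move=> A B E g f; apply: shom_inj.
Defined.

Lemma counit_is_frobenius_form (A : gv_frobenius C) :
  is_frobenius_form (counit A).
Proof.
have [_ psiK phiK] := frobenius_mapP A.
by exists (frobenius_inv A); rewrite form_mapE.
Qed.

Definition frobenius_form (A : gv_frobenius C) : form_algebra C :=
  FormAlgebra (counit_is_frobenius_form A).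

Lemma frobenius_morphism_is_form_morphism (A B : gv_frobenius C)
    (f : hom A B) :
  is_frobenius_morphism f ->
  is_form_morphism (A := frobenius_form A) (B := frobenius_form B) f.
Proof. by case=> fA _ fe. Qed.

Definition frobenius_to_form :
  functor (frobenius_category C) (form_category C).
Proof.
refine (@Functor (frobenius_category C) (form_category C) frobenius_form
  (fun A B f => exist _ (proj1_sig f)
    (frobenius_morphism_is_form_morphism (proj2_sig f))) _ _).
- by move=> A; apply: shom_inj.
- by move=> A B E g f; apply: shom_inj.
Defined.

Lemma form_to_pairing_faithful : faithful form_to_pairing.
Proof. by move=> A B f g /(congr1 (@proj1_sig _ _)) e; apply: shom_inj. Qed.

Lemma form_to_pairing_full : full form_to_pairing.
Proof.
move=> A B [f Pf]; exists (exist _ f (pairing_morphism_is_form_morphism Pf)).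
exact: shom_inj.
Qed.

(** The form of (A, kappa) is kappa (1, -); the object obtained from it has the
    same algebra and pairing, and the identity of A is the isomorphism. *)
Lemma form_to_pairing_surj : essentially_surjective form_to_pairing.
Proof.
move=> [A kappa inv nondeg].
have kE := unit_formK inv.
have iso_form : is_frobenius_form (unit_form kappa).
  by rewrite /is_frobenius_form form_mapE kE; apply/nondegenerateP.
exists (FormAlgebra iso_form); constructor.
set P := form_to_pairing _; set Q := PairingAlgebra _ _.
have PQ : is_pairing_morphism (A := P) (B := Q) (idm (A : C)).
  by split; [exact: is_algebra_morphism_id | rewrite tensm1 compm1 /= kE].
have QP : is_pairing_morphism (A := Q) (B := P) (idm (A : C)).
  by split; [exact: is_algebra_morphism_id | rewrite tensm1 compm1 /= kE].
by apply: (@Iso (pairing_category C) P Q (exist _ _ PQ) (exist _ _ QP));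
  apply: shom_inj; apply: comp1m.
Qed.

Lemma frobenius_to_form_faithful : faithful frobenius_to_form.
Proof. by move=> A B f g /(congr1 (@proj1_sig _ _)) e; apply: shom_inj. Qed.

Lemma frobenius_to_form_full : full_on_isos frobenius_to_form.
Proof.
move=> A B [f [fA fe]] [[g Pg] [_ /(congr1 (@proj1_sig _ _)) /= fg]].
have Pf : is_frobenius_morphism (A := A) (B := B) f.
  by split=> //; apply: form_isomorphism_comul fg fA fe.
exists (exist _ f Pf).
exact: (@shom_inj _ _ _ (@is_form_morphism C) (frobenius_form A)
  (frobenius_form B)).
Qed.

Lemma frobenius_to_form_surj : essentially_surjective frobenius_to_form.
Proof.
move=> [A lambda iso_form].
have : is_iso (curry D (lambda ∘ mul A)) by rewrite -form_mapE.
move=> /frobenius_of_form[Delta [coalg frobl frobr]].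
exists (GVFrobenius coalg frobl frobr); constructor.
set P := frobenius_to_form _; set Q := FormAlgebra _.
have PQ : is_form_morphism (A := P) (B := Q) (idm (A : C)).
  by split; [exact: is_algebra_morphism_id | rewrite compm1].
have QP : is_form_morphism (A := Q) (B := P) (idm (A : C)).
  by split; [exact: is_algebra_morphism_id | rewrite compm1].
by apply: (@Iso (form_category C) P Q (exist _ _ PQ) (exist _ _ QP));
  apply: shom_inj; apply: comp1m.
Qed.
End Categories.

Theorem theorem4p14 (C : gv_category) :
  is_groupoid (frobenius_category C) /\
  equivalent (frobenius_category C) (core (pairing_category C)) /\
  equivalent (frobenius_category C) (core (form_category C)) /\
  equivalent (pairing_category C) (form_category C).
Proof.
have groupoid := @frobenius_groupoid C.
split=> //; split; [|split].
- exact: equivalent_core groupoid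
    (faithful_comp (@form_to_pairing_faithful C)
      (@frobenius_to_form_faithful C))
    (full_on_isos_comp (@form_to_pairing_faithful C)
      (@form_to_pairing_full C) (@frobenius_to_form_full C))
    (essentially_surjective_comp (@form_to_pairing_surj C)
      (@frobenius_to_form_surj C)).
- exact: equivalent_core groupoid (@frobenius_to_form_faithful C)
    (@frobenius_to_form_full C) (@frobenius_to_form_surj C).
- apply: equivalent_sym.
  exact: equivalent_of_fully_faithful (@form_to_pairing_faithful C)
    (@form_to_pairing_full C) (@form_to_pairing_surj C).
Qed.
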